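(* Let $i\in\mathbb{N}_0$ and let $\alpha,\beta,\epsilon\in\mathbb{C}$. Then $$F^{1:1;2}_{1:0;1}\left[\begin{matrix}\alpha: & \epsilon\,; & \beta-\epsilon,\ 1-\alpha-\epsilon+i\,;\\ \beta: & -\,; & 1-\alpha-\epsilon+\beta+i\,;\end{matrix}\ \tfrac12,\ \tfrac12\right] =\frac{2^{i-\alpha}\,\Gamma(\beta-\epsilon-\alpha+i+1)\,\Gamma(\alpha-i)}{\Gamma(1-2\alpha-\epsilon+\beta+i)\,\Gamma(\alpha)}\sum_{r=0}^{i}(-1)^r\binom{i}{r}\frac{\Gamma\!\left(\frac{1-2\alpha-\epsilon+\beta+i+r}{2}\right)}{\Gamma\!\left(\frac{\beta-\epsilon-i+r+1}{2}\right)}$$ and $$F^{1:1;2}_{1:0;1}\left[\begin{matrix}\alpha: & \epsilon\,; & \beta-\epsilon,\ 1-\alpha-\epsilon-i\,;\\ \beta: & -\,; & 1-\alpha-\epsilon+\beta-i\,;\end{matrix}\ \tfrac12,\ \tfrac12\right] =\frac{2^{-\alpha-i}\,\Gamma(\beta-\epsilon-\alpha-i+1)}{\Gamma(1-2\alpha-\epsilon+\beta-i)}\sum_{r=0}^{i}\binom{i}{r}\frac{\Gamma\!\left(\frac{1-2\alpha-\epsilon+\beta-i+r}{2}\right)}{\Gamma\!\left(\frac{\beta-\epsilon-i+r+1}{2}\right)}.$$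
   Context: For $\lambda\in\mathbb{C}$ and $n\in\mathbb{N}_0$, $(\lambda)_0=1$ and $(\lambda)_n=\lambda(\lambda+1)\cdots(\lambda+n-1)$; $\Gamma$ is Euler's Gamma function and $\binom{i}{r}$ the binomial coefficient. The (generalized) Kampé de Fériet function is defined by $$F^{H:A;B}_{G:C;D}\left[\begin{matrix}(h_H): & (a_A)\,; & (b_B)\,;\\ (g_G): & (c_C)\,; & (d_D)\,;\end{matrix}\ x,\ y\right]=\sum_{m=0}^\infty\sum_{n=0}^\infty\frac{\prod_{j=1}^H(h_j)_{m+n}\prod_{j=1}^A(a_j)_m\prod_{j=1}^B(b_j)_n}{\prod_{j=1}^G(g_j)_{m+n}\prod_{j=1}^C(c_j)_m\prod_{j=1}^D(d_j)_n}\frac{x^m}{m!}\frac{y^n}{n!},$$ where a dash ''$-$'' denotes an empty list of parameters (empty products equal $1$). Parameters are tacitly assumed to be such that the double series converges, no denominator parameter is a non-positive integer, and all Gamma values appearing are finite. *)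

(* Defs.v *)
From Stdlib Require Import Reals List Arith Factorial.
From Coquelicot Require Import Coquelicot.
Open Scope C_scope.

Definition Clim_seq (u : nat -> C) : C :=
  (real (Lim_seq (fun n => fst (u n))), real (Lim_seq (fun n => snd (u n)))).

Definition Cis_lim_seq (u : nat -> C) (l : C) : Prop :=
  is_lim_seq (fun n => fst (u n)) (fst l) /\ is_lim_seq (fun n => snd (u n)) (snd l).

(* a^z = exp(z ln a) for real a > 0, with exp(x+iy) = e^x (cos y + i sin y). *)
Definition Crpow (a : R) (z : C) : C :=
  (exp (Re z * ln a) * cos (Im z * ln a),
   exp (Re z * ln a) * sin (Im z * ln a))%R.

Fixpoint Cnpow (z : C) (n : nat) : C :=
  match n with O => 1 | S k => z * Cnpow z k end.

Fixpoint poch (l : C) (n : nat) : C :=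
  match n with O => 1 | S k => poch l k * (l + RtoC (INR k)) end.

Definition gauss_seq (z : C) (n : nat) : C :=
  RtoC (INR (fact n)) * Crpow (INR n) z / poch z (S n).

(* Euler's Gamma function on C (Gauss' limit formula); meaningful (finite)
   exactly when z is not a non-positive integer. *)
Definition CGamma (z : C) : C := Clim_seq (gauss_seq z).

Definition gamma_finite (z : C) : Prop := forall k : nat, z <> RtoC (- INR k).

Definition prod_poch (ps : list C) (n : nat) : C :=
  fold_right (fun p acc => poch p n * acc) 1 ps.

Definition kdf_term (h g a c b d : list C) (x y : C) (m n : nat) : C :=
  prod_poch h (m + n) * prod_poch a m * prod_poch b n
  / (prod_poch g (m + n) * prod_poch c m * prod_poch d n)
  * (Cnpow x m / RtoC (INR (fact m))) * (Cnpow y n / RtoC (INR (fact n))).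

Definition kdf_partial (h g a c b d : list C) (x y : C) (N : nat) : C :=
  sum_n (fun m => sum_n (fun n => kdf_term h g a c b d x y m n) N) N.

Definition kdf_abs_conv (h g a c b d : list C) (x y : C) : Prop :=
  exists M : R, forall N : nat,
    (sum_n (fun m => sum_n (fun n => Cmod (kdf_term h g a c b d x y m n)) N) N <= M)%R.

(* F^{H:A;B}_{G:C;D}[(h):(a);(b);(g):(c);(d); x, y] *)
Definition KdF (h g a c b d : list C) (x y : C) : C :=
  Clim_seq (kdf_partial h g a c b d x y).

Definition nonpos_int_free (ps : list C) : Prop := List.Forall gamma_finite ps.

Definition Csign (r : nat) : C := Cnpow (RtoC (-1)) r.
Definition Cbinom (i r : nat) : C := RtoC (Binomial.C i r).

(* Main.v *)
Require Import Defs.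
From Stdlib Require Import Reals List Arith Factorial Lra Lia.
From Coquelicot Require Import Coquelicot.
Import ListNotations.
Open Scope C_scope.

(** Along the diagonals [m + n = N] the inner sum of the double series is Saalschuetzian, so
    the Kampe de Feriet function collapses to the Gauss series
    [2F1(alpha, 1 - alpha +- i; d; 1/2)] with [d = 1 - alpha - eps + beta +- i].
    For [i = 0] its regularisation [2F1 / Gamma(d)] satisfies a two-term recurrence
    [d -> d + 2]; iterating it, and using that the series tends to 1 as [d -> oo], gives
    Bailey's theorem through Gauss' limit formula.  Two contiguous relations, which match
    Pascal's rule for the sum over [r], then yield every [i] by induction.
    The entire function [1 / Gamma] is used throughout: the induction for [+i] lowers [d]
    and may pass through its poles. *)

(** The diagonal sums are balanced because the last denominator parameter is beta plus the numerator
    parameter 1 - alpha - eps +- i. Their closed form contains (beta)_N, which cancels the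
    denominator (beta)_N, and (1 - alpha +- i)_N, from which eps has disappeared. [KdF] and [CGamma]
    are limits taken by an operator that returns a value even for divergent sequences, so
    convergence has to be established before any value is computed. For Gamma it comes from an
    infinite product with factors 1 + O(1/n^2); regrouping the double series by diagonals rests on
    the assumed absolute convergence. No reflection or duplication formula enters: the power
    2^(-alpha) appears when Gauss' quotients of index n at half arguments are compared with those of
    index 2n + 1 at the full arguments. *)

Local Notation "# n" := (RtoC (INR n)) (at level 8, format "# n").

(* [sum_n] over [C] has type [AbelianMonoid.sort _], which [ring] does not recognise. *)
Ltac Cring := match goal with |- ?x = ?y => change (@eq C x y) end; ring.
Ltac Cfield := match goal with |- ?x = ?y => change (@eq C x y) end; field.

(** * Limits of complex sequences *)

Lemma Clim_seq_correct (u : nat -> C) (l : C) : Cis_lim_seq u l -> Clim_seq u = l.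
Proof.
  intros [H1 H2]; unfold Clim_seq.
  rewrite (is_lim_seq_unique _ _ H1), (is_lim_seq_unique _ _ H2).
  now destruct l.
Qed.

Lemma Cis_lim_seq_unique (u : nat -> C) (l l' : C) :
  Cis_lim_seq u l -> Cis_lim_seq u l' -> l = l'.
Proof.
  intros H H'.
  now rewrite <- (Clim_seq_correct _ _ H), <- (Clim_seq_correct _ _ H').
Qed.

Lemma Cis_lim_seq_ext_loc (u v : nat -> C) (l : C) (N : nat) :
  (forall n, (N <= n)%nat -> u n = v n) -> Cis_lim_seq u l -> Cis_lim_seq v l.
Proof.
  intros H [H1 H2]; split.
  - apply is_lim_seq_ext_loc with (2 := H1).
    exists N; intros n Hn; now rewrite H.
  - apply is_lim_seq_ext_loc with (2 := H2).
    exists N; intros n Hn; now rewrite H.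
Qed.

Lemma Cis_lim_seq_ext (u v : nat -> C) (l : C) :
  (forall n, u n = v n) -> Cis_lim_seq u l -> Cis_lim_seq v l.
Proof. intros H; apply (Cis_lim_seq_ext_loc _ _ _ 0); auto. Qed.

Lemma Cis_lim_seq_const (a : C) : Cis_lim_seq (fun _ => a) a.
Proof. split; apply is_lim_seq_const. Qed.

Lemma Cis_lim_seq_plus (u v : nat -> C) (l m : C) :
  Cis_lim_seq u l -> Cis_lim_seq v m -> Cis_lim_seq (fun n => u n + v n) (l + m).
Proof. intros [H1 H2] [H3 H4]; split; simpl; now apply is_lim_seq_plus'. Qed.

Lemma Cis_lim_seq_mult (u v : nat -> C) (l m : C) :
  Cis_lim_seq u l -> Cis_lim_seq v m -> Cis_lim_seq (fun n => u n * v n) (l * m).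
Proof.
  intros [H1 H2] [H3 H4]; split; simpl.
  - apply is_lim_seq_minus'; now apply is_lim_seq_mult'.
  - apply is_lim_seq_plus'; now apply is_lim_seq_mult'.
Qed.

Lemma Cis_lim_seq_scal (a : C) (u : nat -> C) (l : C) :
  Cis_lim_seq u l -> Cis_lim_seq (fun n => a * u n) (a * l).
Proof. intros H; apply Cis_lim_seq_mult; [apply Cis_lim_seq_const | exact H]. Qed.

Lemma C_norm2_neq_0 (l : C) : l <> 0 -> (fst l ^ 2 + snd l ^ 2 <> 0)%R.
Proof.
  intros Hl H; apply Hl; destruct l as [x y]; simpl in H.
  assert (x = 0)%R by nra; assert (y = 0)%R by nra; now subst.
Qed.

Lemma Cis_lim_seq_inv (u : nat -> C) (l : C) :
  l <> 0 -> Cis_lim_seq u l -> Cis_lim_seq (fun n => / u n) (/ l).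
Proof.
  intros Hl [H1 H2].
  assert (H : is_lim_seq (fun n => (fst (u n) ^ 2 + snd (u n) ^ 2)%R)
                (fst l ^ 2 + snd l ^ 2)%R).
  { apply is_lim_seq_plus'; simpl;
      repeat apply is_lim_seq_mult'; trivial; apply is_lim_seq_const. }
  split; simpl; apply is_lim_seq_div'; trivial; try now apply C_norm2_neq_0.
  apply -> (is_lim_seq_opp (fun n => snd (u n)) (snd l)); exact H2.
Qed.

Lemma Cis_lim_seq_subseq (u : nat -> C) (l : C) (phi : nat -> nat) :
  filterlim phi eventually eventually ->
  Cis_lim_seq u l -> Cis_lim_seq (fun n => u (phi n)) l.
Proof.
  intros Hp [H1 H2]; split.
  - apply (is_lim_seq_subseq _ _ _ Hp H1).
  - apply (is_lim_seq_subseq _ _ _ Hp H2).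
Qed.

Lemma Cis_lim_seq_S (u : nat -> C) (l : C) :
  Cis_lim_seq u l -> Cis_lim_seq (fun n => u (S n)) l.
Proof.
  intros [H1 H2]; split.
  - now apply -> is_lim_seq_incr_1 in H1.
  - now apply -> is_lim_seq_incr_1 in H2.
Qed.

Lemma Rabs_fst_le_Cmod (z : C) : (Rabs (fst z) <= Cmod z)%R.
Proof. eapply Rle_trans; [apply Rmax_l | apply Rmax_Cmod]. Qed.

Lemma Rabs_snd_le_Cmod (z : C) : (Rabs (snd z) <= Cmod z)%R.
Proof. eapply Rle_trans; [apply Rmax_r | apply Rmax_Cmod]. Qed.

Lemma Cmod_le_abs (z : C) : (Cmod z <= Rabs (fst z) + Rabs (snd z))%R.
Proof.
  destruct z as [x y]; simpl.
  replace (x, y) with (RtoC x + Ci * RtoC y) by (apply injective_projections; simpl; ring).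
  eapply Rle_trans; [apply Cmod_triangle|].
  rewrite Cmod_mult, Cmod_Ci, !Cmod_R; lra.
Qed.

Lemma Cis_lim_seq_0_le (u : nat -> C) (e : nat -> R) :
  (forall n, (Cmod (u n) <= e n)%R) -> is_lim_seq e 0%R -> Cis_lim_seq u 0.
Proof.
  intros H He; split; simpl; apply is_lim_seq_abs_0.
  - apply is_lim_seq_le_le with (fun _ => 0%R) e; trivial; [|apply is_lim_seq_const].
    intros n; split; [apply Rabs_pos|].
    eapply Rle_trans; [apply Rabs_fst_le_Cmod | apply H].
  - apply is_lim_seq_le_le with (fun _ => 0%R) e; trivial; [|apply is_lim_seq_const].
    intros n; split; [apply Rabs_pos|].
    eapply Rle_trans; [apply Rabs_snd_le_Cmod | apply H].
Qed.

(** * Complex series *)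

Definition Cis_series (a : nat -> C) (l : C) : Prop := Cis_lim_seq (sum_n a) l.

Lemma Csum_O (a : nat -> C) : sum_n a 0 = a 0%nat.
Proof. apply sum_O. Qed.

Lemma Csum_S (a : nat -> C) (n : nat) : sum_n a (S n) = sum_n a n + a (S n).
Proof. exact (sum_Sn (G := C_AbelianMonoid) a n). Qed.

Lemma Csum_plus (a b : nat -> C) (n : nat) :
  sum_n (fun k => a k + b k) n = sum_n a n + sum_n b n.
Proof. exact (sum_n_plus (G := C_AbelianMonoid) a b n). Qed.

Lemma Csum_scal (x : C) (a : nat -> C) (n : nat) :
  sum_n (fun k => x * a k) n = x * sum_n a n.
Proof. exact (sum_n_mult_l (K := C_Ring) x a n). Qed.

Lemma Csum_shift (a : nat -> C) (n : nat) :
  sum_n a (S n) = a 0%nat + sum_n (fun k => a (S k)) n.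
Proof.
  induction n as [|n IH].
  - now rewrite Csum_S, !Csum_O.
  - rewrite Csum_S, IH, (Csum_S (fun k => a (S k))); Cring.
Qed.

Lemma fst_Csum (a : nat -> C) (n : nat) : fst (sum_n a n) = sum_n (fun k => fst (a k)) n.
Proof.
  induction n as [|n IH]; [now rewrite Csum_O, sum_O|].
  rewrite Csum_S, sum_Sn, <- IH; reflexivity.
Qed.

Lemma snd_Csum (a : nat -> C) (n : nat) : snd (sum_n a n) = sum_n (fun k => snd (a k)) n.
Proof.
  induction n as [|n IH]; [now rewrite Csum_O, sum_O|].
  rewrite Csum_S, sum_Sn, <- IH; reflexivity.
Qed.

Lemma Cmod_Csum_le (a : nat -> C) (n : nat) :
  (Cmod (sum_n a n) <= sum_n (fun k => Cmod (a k)) n)%R.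
Proof.
  induction n as [|n IH]; [rewrite Csum_O, sum_O; apply Rle_refl|].
  rewrite Csum_S, sum_Sn.
  eapply Rle_trans; [apply Cmod_triangle|].
  apply Rplus_le_compat_r, IH.
Qed.

Lemma Cis_series_ext (a b : nat -> C) (l : C) :
  (forall n, a n = b n) -> Cis_series a l -> Cis_series b l.
Proof.
  intros H; apply Cis_lim_seq_ext; intros n; now apply sum_n_ext.
Qed.

Lemma Cis_series_plus (a b : nat -> C) (l m : C) :
  Cis_series a l -> Cis_series b m -> Cis_series (fun n => a n + b n) (l + m).
Proof.
  intros Ha Hb; apply Cis_lim_seq_ext with (fun n => sum_n a n + sum_n b n).
  - intros n; now rewrite Csum_plus.
  - now apply Cis_lim_seq_plus.
Qed.

Lemma Cis_series_scal (x : C) (a : nat -> C) (l : C) :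
  Cis_series a l -> Cis_series (fun n => x * a n) (x * l).
Proof.
  intros Ha; apply Cis_lim_seq_ext with (fun n => x * sum_n a n).
  - intros n; now rewrite Csum_scal.
  - now apply Cis_lim_seq_scal.
Qed.

Lemma Cis_series_incr (a : nat -> C) (l : C) :
  Cis_series (fun n => a (S n)) l -> Cis_series a (a 0%nat + l).
Proof.
  intros H.
  assert (K := Cis_lim_seq_plus _ _ _ _ (Cis_lim_seq_const (a 0%nat)) H).
  destruct K as [K1 K2]; split; apply is_lim_seq_incr_1.
  - apply is_lim_seq_ext with (2 := K1); intros n; now rewrite Csum_shift.
  - apply is_lim_seq_ext with (2 := K2); intros n; now rewrite Csum_shift.
Qed.

Lemma Cis_series_telescope (g : nat -> C) :
  Cis_lim_seq g 0 -> Cis_series (fun n => g (S n) - g n) (- g 0%nat).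
Proof.
  intros H; apply Cis_lim_seq_ext with (fun n => - g 0%nat + g (S n)).
  - intros n; induction n as [|n IH]; [rewrite Csum_O; Cring|].
    rewrite Csum_S, <- IH; Cring.
  - assert (K := Cis_lim_seq_plus _ _ _ _ (Cis_lim_seq_const (- g 0%nat))
                   (Cis_lim_seq_S _ _ H)).
    now rewrite Cplus_0_r in K.
Qed.

Lemma ex_Cis_series_abs (a : nat -> C) :
  ex_series (fun n => Cmod (a n)) -> exists l, Cis_series a l.
Proof.
  intros H.
  assert (H1 : ex_series (fun n => fst (a n))).
  { apply (@ex_series_le R_AbsRing R_CompleteNormedModule) with (2 := H).
    intros n; apply Rabs_fst_le_Cmod. }
  assert (H2 : ex_series (fun n => snd (a n))).
  { apply (@ex_series_le R_AbsRing R_CompleteNormedModule) with (2 := H).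
    intros n; apply Rabs_snd_le_Cmod. }
  destruct H1 as [x Hx], H2 as [y Hy]; exists (x, y); split; simpl.
  - apply is_lim_seq_ext with (2 := Hx); intros n; symmetry; apply fst_Csum.
  - apply is_lim_seq_ext with (2 := Hy); intros n; symmetry; apply snd_Csum.
Qed.

Lemma Cis_series_lim_0 (a : nat -> C) (l : C) : Cis_series a l -> Cis_lim_seq a 0.
Proof.
  intros H.
  destruct (Cis_lim_seq_plus _ _ _ _ (Cis_lim_seq_S _ _ H)
              (Cis_lim_seq_scal (-(1)) _ _ H)) as [K1 K2].
  replace (l + -(1) * l) with (RtoC 0) in K1, K2 by ring.
  split; apply is_lim_seq_incr_1.
  - apply is_lim_seq_ext with (2 := K1); intros n; f_equal; rewrite Csum_S; Cring.
  - apply is_lim_seq_ext with (2 := K2); intros n; f_equal; rewrite Csum_S; Cring.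
Qed.

Lemma Cmod_lim_le (u : nat -> C) (l : C) (M : R) :
  Cis_lim_seq u l -> (forall n, (Cmod (u n) <= M)%R) -> (Cmod l <= M)%R.
Proof.
  intros [H1 H2] H.
  assert (HM : (0 <= M)%R) by (eapply Rle_trans; [apply Cmod_ge_0 | apply (H 0%nat)]).
  assert (K : is_lim_seq (fun n => (fst (u n) ^ 2 + snd (u n) ^ 2)%R)
                (fst l ^ 2 + snd l ^ 2)%R).
  { apply is_lim_seq_plus'; simpl;
      repeat apply is_lim_seq_mult'; trivial; apply is_lim_seq_const. }
  unfold Cmod; rewrite <- (sqrt_pow2 M HM); apply sqrt_le_1_alt.
  assert (L : forall n, (fst (u n) ^ 2 + snd (u n) ^ 2 <= M ^ 2)%R).
  { intros n; specialize (H n); change (Re (u n) ^ 2 + Im (u n) ^ 2 <= M ^ 2)%R.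
    rewrite <- Cmod2_alt.
    apply pow_incr; split; [apply Cmod_ge_0 | exact H]. }
  exact (is_lim_seq_le _ _ _ _ L K (is_lim_seq_const (M ^ 2)%R)).
Qed.

Lemma Cmod_series_le (a : nat -> C) (b : nat -> R) (l : C) :
  Cis_series a l -> (forall n, (Cmod (a n) <= b n)%R) -> ex_series b ->
  (Cmod l <= Series b)%R.
Proof.
  intros Ha Hab Hb.
  apply Cmod_lim_le with (1 := Ha); intros n.
  eapply Rle_trans; [apply Cmod_Csum_le|].
  eapply Rle_trans; [apply sum_n_m_le; intros k; apply Hab|].
  apply Series_correct in Hb.
  apply (is_lim_seq_incr_compare (sum_n b)); [exact Hb|].
  intros k; rewrite sum_Sn; unfold plus; simpl.
  generalize (Cmod_ge_0 (a (S k))) (Hab (S k)); lra.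
Qed.

(** The ratio test without quotients: the terms of a terminating hypergeometric series vanish from
    some point on. *)
Lemma ex_series_ratio (t : nat -> R) (q : R) (N : nat) :
  (0 <= q < 1)%R -> (forall n, (0 <= t n)%R) ->
  (forall n, (N <= n)%nat -> (t (S n) <= q * t n)%R) -> ex_series t.
Proof.
  intros Hq Ht H.
  apply (ex_series_incr_n t N).
  apply (@ex_series_le R_AbsRing R_CompleteNormedModule) with (fun n => (t N * q ^ n)%R).
  - intros n; change (norm (t (N + n)%nat)) with (Rabs (t (N + n)%nat)).
    rewrite Rabs_pos_eq by apply Ht.
    induction n as [|n IH]; [rewrite Nat.add_0_r; simpl; lra|].
    replace (N + S n)%nat with (S (N + n)) by lia.
    eapply Rle_trans; [apply H; lia|]; simpl.
    replace (t N * (q * q ^ n))%R with (q * (t N * q ^ n))%R by ring.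
    apply Rmult_le_compat_l; [apply Hq | exact IH].
  - apply (ex_series_scal (V := R_NormedModule) (t N) (fun n => (q ^ n)%R)), ex_series_geom.
    rewrite Rabs_pos_eq; apply Hq.
Qed.

(** * Complex powers of positive reals *)

Lemma RtoC_S (n : nat) : #(S n) = #n + 1.
Proof. now rewrite S_INR, RtoC_plus. Qed.

Lemma RtoC_S_neq_0 (n : nat) : #(S n) <> 0.
Proof. intros H; apply RtoC_inj in H; now apply (not_0_INR (S n)). Qed.

Lemma RtoC_fact_S (n : nat) : #(fact (S n)) = #(S n) * #(fact n).
Proof. rewrite fact_simpl, mult_INR; apply RtoC_mult. Qed.

Lemma RtoC_fact_neq_0 (n : nat) : #(fact n) <> 0.
Proof. intros H; apply RtoC_inj in H; now apply (INR_fact_neq_0 n). Qed.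

Lemma Crpow_plus (x : R) (z w : C) : Crpow x (z + w) = Crpow x z * Crpow x w.
Proof.
  apply injective_projections; unfold Crpow, Re, Im; simpl;
    rewrite !Rmult_plus_distr_r, exp_plus.
  - rewrite cos_plus; ring.
  - rewrite sin_plus; ring.
Qed.

Lemma Crpow_mult (x y : R) (z : C) :
  (0 < x)%R -> (0 < y)%R -> Crpow (x * y) z = Crpow x z * Crpow y z.
Proof.
  intros Hx Hy; apply injective_projections; unfold Crpow, Re, Im; simpl;
    rewrite (ln_mult _ _ Hx Hy), !Rmult_plus_distr_l, exp_plus.
  - rewrite cos_plus; ring.
  - rewrite sin_plus; ring.
Qed.

Lemma Crpow_0 (x : R) : Crpow x 0 = 1.
Proof.
  apply injective_projections; unfold Crpow, Re, Im; simpl; rewrite !Rmult_0_l, exp_0.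
  - rewrite cos_0; ring.
  - rewrite sin_0; ring.
Qed.

Lemma Crpow_1 (x : R) : (0 < x)%R -> Crpow x 1 = RtoC x.
Proof.
  intros Hx; apply injective_projections; unfold Crpow, Re, Im; simpl; rewrite Rmult_0_l, Rmult_1_l, exp_ln by exact Hx.
  - rewrite cos_0; ring.
  - rewrite sin_0; ring.
Qed.

Lemma Crpow_opp (x : R) (z : C) : Crpow x z * Crpow x (- z) = 1.
Proof. rewrite <- Crpow_plus, Cplus_opp_r; apply Crpow_0. Qed.

Lemma Crpow_neq_0 (x : R) (z : C) : Crpow x z <> 0.
Proof.
  intros H; apply C1_nz; rewrite <- (Crpow_opp x z), H; ring.
Qed.

Lemma Crpow_inv (x : R) (z : C) : (0 < x)%R -> Crpow (/ x) z = Crpow x (- z).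
Proof.
  intros Hx; unfold Crpow; rewrite ln_Rinv by exact Hx; simpl.
  replace (Re z * - ln x)%R with (- Re z * ln x)%R by ring.
  now replace (Im z * - ln x)%R with (- Im z * ln x)%R by ring.
Qed.

Lemma Cis_lim_seq_Crpow (u : nat -> R) (x : R) (z : C) :
  (0 < x)%R -> is_lim_seq u x -> Cis_lim_seq (fun n => Crpow (u n) z) (Crpow x z).
Proof.
  intros Hx Hu.
  assert (Hl : is_lim_seq (fun n => ln (u n)) (ln x)).
  { apply is_lim_seq_continuous; [|exact Hu].
    apply derivable_continuous_pt; exists (/ x)%R; now apply derivable_pt_lim_ln. }
  assert (He : is_lim_seq (fun n => exp (Re z * ln (u n))) (exp (Re z * ln x))).
  { apply is_lim_seq_continuous;
      [apply derivable_continuous_pt, derivable_pt_exp|].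
    apply is_lim_seq_mult'; [apply is_lim_seq_const | exact Hl]. }
  assert (Hi : is_lim_seq (fun n => (Im z * ln (u n))%R) (Im z * ln x)%R)
    by (apply is_lim_seq_mult'; [apply is_lim_seq_const | exact Hl]).
  split; simpl; apply is_lim_seq_mult'; trivial; apply is_lim_seq_continuous; trivial.
  - apply continuity_cos.
  - apply continuity_sin.
Qed.

(** * Second-order bounds for cos, sin, exp and ln *)

Lemma one_minus_cos_bound (y : R) : (0 <= 1 - cos y <= y ^ 2 / 2)%R.
Proof.
  assert (Hsin : forall t, (0 <= t -> Rabs (sin t) <= t)%R).
  { intros t [Ht| <-]; [|rewrite sin_0, Rabs_R0; lra].
    destruct (MVT_cor2 sin cos 0 t Ht) as [c [Hc _]];
      [intros; apply derivable_pt_lim_sin|].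
    rewrite sin_0, !Rminus_0_r in Hc; rewrite Hc, Rabs_mult, (Rabs_pos_eq t) by lra.
    generalize (COS_bound c); intros [H1 H2].
    assert (Rabs (cos c) <= 1)%R by (apply Rabs_le; lra). nra. }
  assert (H : (Rabs (sin (y / 2)) <= Rabs (y / 2))%R).
  { destruct (Rle_dec 0 (y / 2)) as [Hy|Hy].
    - rewrite (Rabs_pos_eq (y / 2)) by exact Hy; now apply Hsin.
    - rewrite <- (Rabs_Ropp (sin _)), <- sin_neg, <- (Rabs_Ropp (y / 2)).
      rewrite (Rabs_pos_eq (- _)) by lra; apply Hsin; lra. }
  (* Since 1 - cos y = 2 sin^2(y/2), the bound on the sine at the half angle gives the constant
     1/2. *)
  replace (cos y) with (1 - 2 * sin (y / 2) * sin (y / 2))%R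
    by (rewrite <- cos_2a_sin; f_equal; field).
  assert (H2 : ((sin (y / 2)) ^ 2 <= (y / 2) ^ 2)%R).
  { rewrite <- (pow2_abs (sin _)), <- (pow2_abs (y / 2)).
    apply pow_incr; split; [apply Rabs_pos | exact H]. }
  generalize (pow2_ge_0 (sin (y / 2))); lra.
Qed.

Lemma sin_sub_id_bound (y : R) : (Rabs y <= 1 -> Rabs (sin y - y) <= y ^ 2)%R.
Proof.
  assert (Hpos : forall t, (0 <= t <= 1 -> Rabs (sin t - t) <= t ^ 2)%R).
  { intros t [[Ht| <-] Ht1]; [|rewrite sin_0, Rminus_0_r, Rabs_R0; lra].
    destruct (MVT_cor2 sin cos 0 t Ht) as [c [Hc Hct]];
      [intros; apply derivable_pt_lim_sin|].
    rewrite sin_0, !Rminus_0_r in Hc; rewrite Hc.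
    generalize (one_minus_cos_bound c); intros Hb.
    apply Rabs_le; split; nra. }
  intros Hy; destruct (Rle_dec 0 y) as [H|H].
  - apply Hpos; rewrite Rabs_pos_eq in Hy; lra.
  - rewrite Rabs_left in Hy by lra.
    replace (sin y - y)%R with (- (sin (- y) - - y))%R by (rewrite sin_neg; ring).
    rewrite Rabs_Ropp; replace (y ^ 2)%R with ((- y) ^ 2)%R by ring.
    apply Hpos; lra.
Qed.

Lemma exp_taylor1_bound (x : R) : (Rabs x <= / 2 -> 0 <= exp x - 1 - x <= 2 * x ^ 2)%R.
Proof.
  intros Hx; apply Rabs_le_between in Hx.
  split; [generalize (exp_ineq1_le x); lra|].
  assert (H : (exp x * (1 - x) <= 1)%R).
  { generalize (exp_ineq1_le (- x)) (exp_pos x); rewrite exp_Ropp; intros H1 H2.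
    apply Rmult_le_compat_l with (r := exp x) in H1; [|lra].
    rewrite Rinv_r in H1 by lra; lra. }
  (* After multiplication by 1 - x the left side is at most x^2, because exp x (1 - x) <= 1; and 1 -
     x >= 1/2 accounts for the factor 2. *)
  apply Rmult_le_reg_r with (1 - x)%R; nra.
Qed.

(** Applied to x + iy = z ln q with q close to 1, it controls the power q^z to second order in ln
    q. *)
Lemma Cexp_taylor1_bound (x y : R) :
  (Rabs x <= / 2 -> Rabs y <= / 2 ->
   Cmod ((exp x * cos y, exp x * sin y)%R - 1 - (x, y))
   <= 4 * (Rabs x + Rabs y) ^ 2)%R.
Proof.
  intros Hx Hy.
  eapply Rle_trans; [apply Cmod_le_abs|]; simpl.
  assert (E := exp_taylor1_bound x Hx).
  assert (Co := one_minus_cos_bound y).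
  assert (Si := sin_sub_id_bound y ltac:(lra)).
  assert (H1 : (Rabs (exp x * cos y + - (1) + - x) <= 2 * x ^ 2 + y ^ 2)%R).
  { replace (exp x * cos y + - (1) + - x)%R
      with ((exp x - 1 - x) * cos y - (1 + x) * (1 - cos y))%R by ring.
    generalize (COS_bound y); intros Hc; apply Rabs_le_between in Hx.
    apply Rabs_le; split; nra. }
  assert (H2 : (Rabs (exp x * sin y + - 0 + - y) <= 4 * (Rabs x * Rabs y) + y ^ 2)%R).
  { replace (exp x * sin y + - 0 + - y)%R
      with ((exp x - 1) * sin y + (sin y - y))%R by ring.
    eapply Rle_trans; [apply Rabs_triang|].
    apply Rplus_le_compat; [|exact Si].
    rewrite Rabs_mult.
    assert (Hsy : (Rabs (sin y) <= 2 * Rabs y)%R).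
    { replace (sin y) with ((sin y - y) + y)%R by ring.
      eapply Rle_trans; [apply Rabs_triang|].
      rewrite <- (pow2_abs y) in Si; generalize (Rabs_pos y); nra. }
    assert (Hex : (Rabs (exp x - 1) <= 2 * Rabs x)%R).
    { replace (exp x - 1)%R with ((exp x - 1 - x) + x)%R by ring.
      eapply Rle_trans; [apply Rabs_triang|].
      rewrite (Rabs_pos_eq (exp x - 1 - x)) by lra.
      rewrite <- (pow2_abs x) in E; generalize (Rabs_pos x); nra. }
    generalize (Rabs_pos (sin y)) (Rabs_pos (exp x - 1)) (Rabs_pos x) (Rabs_pos y); nra. }
  rewrite <- (pow2_abs x), <- (pow2_abs y) in *.
  generalize (Rabs_pos x) (Rabs_pos y); simpl in *; nra.
Qed.

(** Both bounds are ln x <= x - 1, taken at the quotient and at its reciprocal. They differ by only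
    1/((n+1)(n+2)), which is what makes the errors in Gauss' product summable. *)
Lemma ln_ratio_bound (n : nat) :
  (/ INR (S (S n)) <= ln (INR (S (S n)) / INR (S n)) <= / INR (S n))%R.
Proof.
  assert (H1 : (0 < INR (S n))%R) by (apply lt_0_INR; lia).
  assert (H2 : (0 < INR (S (S n)))%R) by (apply lt_0_INR; lia).
  assert (E : INR (S (S n)) = (INR (S n) + 1)%R) by apply S_INR.
  assert (Hln : forall x, (0 < x -> ln x <= x - 1)%R).
  { intros x Hx; generalize (exp_ineq1_le (ln x)); rewrite exp_ln by exact Hx; lra. }
  split.
  - replace (INR (S (S n)) / INR (S n))%R with (/ (INR (S n) / INR (S (S n))))%R
      by (field; lra).
    assert (Hq : (0 < INR (S n) / INR (S (S n)))%R) by now apply Rdiv_lt_0_compat.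
    rewrite ln_Rinv by exact Hq.
    replace (/ INR (S (S n)))%R with (- (INR (S n) / INR (S (S n)) - 1))%R
      by (rewrite E; field; lra).
    apply Ropp_le_contravar, Hln, Hq.
  - replace (/ INR (S n))%R with (INR (S (S n)) / INR (S n) - 1)%R
      by (rewrite E; field; lra).
    apply Hln, Rdiv_lt_0_compat; assumption.
Qed.

(** * Infinite products *)

Lemma sum_n_le_Series (a : nat -> R) (n : nat) :
  (forall k, (0 <= a k)%R) -> ex_series a -> (sum_n a n <= Series a)%R.
Proof.
  intros Ha H; apply Series_correct in H.
  apply (is_lim_seq_incr_compare (sum_n a)); [exact H|].
  intros k; rewrite sum_Sn; unfold plus; simpl; generalize (Ha (S k)); lra.
Qed.

Lemma exp_le_compat (x y : R) : (x <= y -> exp x <= exp y)%R.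
Proof. intros [H| ->]; [left; now apply exp_increasing | apply Rle_refl]. Qed.

(** From 1 + |e| <= exp |e| the partial products stay below a bound [B]. Their increments u n * e n
    are then dominated by B |e n|, so u is the partial sum of an absolutely convergent series. *)
Lemma Cprod_converges (u e : nat -> C) :
  ex_series (fun n => Cmod (e n)) -> (forall n, u (S n) = u n * (1 + e n)) ->
  exists l, Cis_lim_seq u l.
Proof.
  intros He Hu.
  set (B := (Cmod (u 0%nat) * exp (Series (fun n => Cmod (e n))))%R).
  assert (HB1 : forall n, (Cmod (u (S n)) <= Cmod (u 0%nat) * exp (sum_n (fun n => Cmod (e n)) n))%R).
  { assert (Hstep : forall n, (Cmod (u (S n)) <= Cmod (u n) * exp (Cmod (e n)))%R).
    { intros n; rewrite Hu, Cmod_mult.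
      apply Rmult_le_compat_l; [apply Cmod_ge_0|].
      eapply Rle_trans; [apply Cmod_triangle|]; rewrite Cmod_1; apply exp_ineq1_le. }
    intros n; induction n as [|n IH]; [rewrite sum_O; apply Hstep|].
    rewrite sum_Sn; unfold plus; simpl; rewrite exp_plus, <- Rmult_assoc.
    eapply Rle_trans; [apply Hstep|].
    apply Rmult_le_compat_r; [left; apply exp_pos | exact IH]. }
  assert (HB : forall n, (Cmod (u n) <= B)%R).
  { assert (HS : forall n, (sum_n (fun n => Cmod (e n)) n <= Series (fun n => Cmod (e n)))%R)
      by (intros n; apply sum_n_le_Series; trivial; intros; apply Cmod_ge_0).
    intros [|n].
    - unfold B; rewrite <- (Rmult_1_r (Cmod (u 0%nat))) at 1.
      apply Rmult_le_compat_l; [apply Cmod_ge_0|].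
      rewrite <- exp_0; apply exp_le_compat.
      eapply Rle_trans; [|apply (HS 0%nat)]; rewrite sum_O; apply Cmod_ge_0.
    - eapply Rle_trans; [apply HB1|].
      apply Rmult_le_compat_l; [apply Cmod_ge_0|]; apply exp_le_compat, HS. }
  destruct (ex_Cis_series_abs (fun n => u n * e n)) as [l Hl].
  { apply (@ex_series_le R_AbsRing R_CompleteNormedModule)
      with (fun n => (B * Cmod (e n))%R).
    - intros n; change (Rabs (Cmod (u n * e n)) <= B * Cmod (e n))%R.
      rewrite Rabs_pos_eq, Cmod_mult by apply Cmod_ge_0.
      apply Rmult_le_compat_r; [apply Cmod_ge_0 | apply HB].
    - exact (ex_series_scal (V := R_NormedModule) B (fun n => Cmod (e n)) He). }
  exists (u 0%nat + l).
  assert (Hsum : forall n, u 0%nat + sum_n (fun n => u n * e n) n = u (S n)).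
  { intros n; induction n as [|n IH].
    - rewrite Csum_O, Hu; Cring.
    - rewrite Csum_S, (Hu (S n)), <- IH; Cring. }
  destruct (Cis_lim_seq_ext _ _ _ Hsum
              (Cis_lim_seq_plus _ _ _ _ (Cis_lim_seq_const (u 0%nat)) Hl)) as [K1 K2].
  split; apply is_lim_seq_incr_1; assumption.
Qed.

(** Once |e| <= 1/2, the reciprocals form a product of the same kind, with errors -e/(1+e) of
    modulus at most 2|e|. They converge too, and the product of the two limits is 1. *)
Lemma Cprod_lim_neq_0 (u e : nat -> C) (l : C) :
  ex_series (fun n => Cmod (e n)) -> (forall n, u (S n) = u n * (1 + e n)) ->
  (forall n, u n <> 0) -> Cis_lim_seq u l -> l <> 0.
Proof.
  intros He Hu Hnz Hl.
  assert (Hsmall : exists N, forall n, (N <= n)%nat -> (Cmod (e n) <= / 2)%R).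
  { assert (H0 := ex_series_lim_0 _ He).
    apply is_lim_seq_spec in H0.
    destruct (H0 (mkposreal (/ 2) ltac:(lra))) as [N HN]; exists N; intros n Hn.
    specialize (HN n Hn); simpl in HN; rewrite Rminus_0_r in HN.
    rewrite Rabs_pos_eq in HN by apply Cmod_ge_0; lra. }
  destruct Hsmall as [N HN].
  assert (Hlow : forall n, (N <= n)%nat -> (/ 2 <= Cmod (1 + e n))%R).
  { intros n Hn; specialize (HN n Hn).
    assert (H := Cmod_triangle (1 + e n) (- e n)).
    replace (1 + e n + - e n) with (RtoC 1) in H by ring.
    rewrite Cmod_1, Cmod_opp in H; lra. }
  assert (Hne : forall n, 1 + e (N + n)%nat <> 0).
  { intros n; apply Cmod_gt_0; eapply Rlt_le_trans; [|apply Hlow; lia]; lra. }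
  destruct (Cprod_converges (fun n => / u (N + n)%nat)
              (fun n => - e (N + n)%nat / (1 + e (N + n)%nat))) as [m Hm].
  { apply (@ex_series_le R_AbsRing R_CompleteNormedModule)
      with (fun n => (2 * Cmod (e (N + n)%nat))%R).
    - intros n.
      change (Rabs (Cmod (- e (N + n)%nat / (1 + e (N + n)%nat)))
              <= 2 * Cmod (e (N + n)%nat))%R.
      rewrite Rabs_pos_eq by apply Cmod_ge_0.
      rewrite Cmod_div, Cmod_opp by apply Hne.
      assert (H := Hlow (N + n)%nat ltac:(lia)).
      apply Rle_div_l; [lra|].
      generalize (Cmod_ge_0 (e (N + n)%nat)); nra.
    - apply (ex_series_scal (V := R_NormedModule) 2%R (fun n => Cmod (e (N + n)%nat))).
      now apply (ex_series_incr_n (fun n => Cmod (e n)) N). }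
  { intros n; replace (N + S n)%nat with (S (N + n)) by lia; rewrite Hu.
    field; split; [apply Hne | apply Hnz]. }
  assert (Hl' : Cis_lim_seq (fun n => u (N + n)%nat) l).
  { apply (Cis_lim_seq_subseq u l (fun n => (N + n)%nat)); [|exact Hl].
    apply eventually_subseq; intros; lia. }
  assert (H1 := Cis_lim_seq_mult _ _ _ _ Hl' Hm).
  assert (H2 : Cis_lim_seq (fun n => u (N + n)%nat * / u (N + n)%nat) 1).
  { apply Cis_lim_seq_ext with (fun _ => RtoC 1); [|apply Cis_lim_seq_const].
    intros n; symmetry; apply Cinv_r, Hnz. }
  assert (H := Cis_lim_seq_unique _ _ _ H1 H2).
  intros ->; rewrite Cmult_0_l in H; now apply C1_nz.
Qed.

(** * The reciprocal Gamma function *)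

(** The reciprocal of Gauss' quotient: the Pochhammer symbol moves to the numerator, so the limit
    exists at every z and is 1/Gamma extended over the poles. *)
Definition rgauss (z : C) (n : nat) : C :=
  poch z (S n) / (#(fact n) * Crpow (INR n) z).

Definition rGamma (z : C) : C := Clim_seq (rgauss z).

(** The relative increment from index n + 1 to n + 2; index 0 is skipped because [Crpow] at base 0
    rests on a default value of [ln]. *)
Definition rgauss_err (z : C) (n : nat) : C :=
  (1 + z / #(S (S n))) * Crpow (INR (S n) / INR (S (S n))) z - 1.

Lemma rgauss_S (z : C) (n : nat) :
  rgauss z (S (S n)) = rgauss z (S n) * (1 + rgauss_err z n).
Proof.
  assert (H1 : (0 < INR (S n))%R) by (apply lt_0_INR; lia).
  assert (H2 : (0 < INR (S (S n)))%R) by (apply lt_0_INR; lia).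
  unfold rgauss, rgauss_err.
  assert (E : Crpow (INR (S n)) z
              = Crpow (INR (S n) / INR (S (S n))) z * Crpow (INR (S (S n))) z).
  { rewrite <- Crpow_mult; trivial; [|now apply Rdiv_lt_0_compat].
    f_equal; field; lra. }
  rewrite E.
  change (poch z (S (S (S n)))) with (poch z (S (S n)) * (z + #(S (S n)))).
  rewrite (RtoC_fact_S (S n)).
  field; repeat split; try apply Crpow_neq_0; try apply RtoC_fact_neq_0;
    apply RtoC_S_neq_0.
Qed.

(** The factors 1 + z/t and (s/t)^z = 1 - z ln(t/s) + ... cancel to first order, leaving O(1/n^2).
    The hypothesis ensures |z| ln(t/s) <= 1/2, the range of the Taylor bound. *)
Lemma Cmod_rgauss_err_le (z : C) (n : nat) :
  (2 * Cmod z <= INR (S n) ->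
   Cmod (rgauss_err z n)
   <= (Cmod z + Cmod z ^ 2 + 32 * (1 + Cmod z) * Cmod z ^ 2)
      * (/ INR (S n) * / INR (S (S n))))%R.
Proof.
  intros Hn.
  assert (H1 : (1 <= INR (S n))%R) by (rewrite S_INR; generalize (pos_INR n); lra).
  assert (E : INR (S (S n)) = (INR (S n) + 1)%R) by apply S_INR.
  unfold rgauss_err.
  set (L := ln (INR (S (S n)) / INR (S n))).
  assert (HL := ln_ratio_bound n); fold L in HL.
  set (s := INR (S n)) in *; set (t := INR (S (S n))) in *.
  assert (HLs : (0 <= L)%R) by (eapply Rle_trans; [|apply HL]; left; apply Rinv_0_lt_compat; lra).
  assert (Hln : ln (s / t) = (- L)%R).
  { unfold L; rewrite <- ln_Rinv by (apply Rdiv_lt_0_compat; lra); f_equal; field; lra. }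
  set (rem := Crpow (s / t) z - 1 - (- (RtoC L * z))).
  assert (HzL : (Cmod z * L <= / 2)%R).
  { apply Rle_trans with (Cmod z * / s)%R.
    - apply Rmult_le_compat_l; [apply Cmod_ge_0 | apply HL].
    - apply Rmult_le_reg_r with s; [lra|].
      rewrite Rmult_assoc, Rinv_l by lra; lra. }
  assert (Hx : (Rabs (Re z * - L) <= Cmod z * L)%R).
  { rewrite Rabs_mult, Rabs_Ropp, (Rabs_pos_eq L) by exact HLs.
    apply Rmult_le_compat_r; [exact HLs | apply Rabs_fst_le_Cmod]. }
  assert (Hy : (Rabs (Im z * - L) <= Cmod z * L)%R).
  { rewrite Rabs_mult, Rabs_Ropp, (Rabs_pos_eq L) by exact HLs.
    apply Rmult_le_compat_r; [exact HLs | apply Rabs_snd_le_Cmod]. }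
  assert (Hrem : (Cmod rem <= 16 * (Cmod z * L) ^ 2)%R).
  { unfold rem.
    replace (- (RtoC L * z)) with ((Re z * - L)%R, (Im z * - L)%R)
      by (apply injective_projections; unfold Re, Im; simpl; ring).
    unfold Crpow; rewrite Hln.
    eapply Rle_trans; [apply Cexp_taylor1_bound; lra|].
    replace (16 * (Cmod z * L) ^ 2)%R with (4 * (Cmod z * L + Cmod z * L) ^ 2)%R by ring.
    apply Rmult_le_compat_l; [lra|]; apply pow_incr; split; [|lra].
    generalize (Rabs_pos (Re z * - L)) (Rabs_pos (Im z * - L)); lra. }
  (* The three summands of the constant bound these three pieces in order; in the last, 32 is 16
     from [Hrem] times 2 from 1/s^2 <= 2/(st). *)
  replace ((1 + z / RtoC t) * Crpow (s / t) z - 1)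
    with (z * RtoC (/ t - L) + - (z * z * RtoC (/ t * L)) + (1 + z * RtoC (/ t)) * rem).
  2: { unfold rem; rewrite RtoC_minus, RtoC_mult, RtoC_inv by lra.
       field; intros H; apply RtoC_inj in H; lra. }
  assert (Hm : (0 <= Cmod z)%R) by apply Cmod_ge_0.
  set (m := Cmod z) in *.
  assert (Ht : (0 < / t <= 1)%R).
  { split; [apply Rinv_0_lt_compat; lra|].
    rewrite <- Rinv_1; apply Rinv_le_contravar; lra. }
  assert (Hs : (0 < / s)%R) by (apply Rinv_0_lt_compat; lra).
  assert (Hst : (/ s - / t = / s * / t)%R) by (rewrite E; field; lra).
  assert (Hs2 : (/ s * / s <= 2 * (/ s * / t))%R).
  { rewrite E, <- !Rinv_mult.
    apply Rmult_le_reg_r with (s * s * (s + 1))%R; [nra|].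
    field_simplify; nra. }
  assert (B1 : (Cmod (z * RtoC (/ t - L)) <= m * (/ s * / t))%R).
  { rewrite Cmod_mult, Cmod_R; fold m.
    apply Rmult_le_compat_l; [exact Hm|]; rewrite <- Hst.
    apply Rabs_le; split; lra. }
  assert (B2 : (Cmod (- (z * z * RtoC (/ t * L))) <= m ^ 2 * (/ s * / t))%R).
  { rewrite Cmod_opp, !Cmod_mult, Cmod_R; fold m; rewrite Rabs_pos_eq by nra.
    replace (m ^ 2)%R with (m * m)%R by ring.
    apply Rmult_le_compat_l; [nra|]; rewrite (Rmult_comm (/ s)).
    apply Rmult_le_compat_l; lra. }
  assert (B3 : (Cmod ((1 + z * RtoC (/ t)) * rem) <= 32 * (1 + m) * m ^ 2 * (/ s * / t))%R).
  { rewrite Cmod_mult.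
    assert (H : (Cmod (1 + z * RtoC (/ t)) <= 1 + m)%R).
    { eapply Rle_trans; [apply Cmod_triangle|].
      rewrite Cmod_1, Cmod_mult, Cmod_R; fold m; rewrite Rabs_pos_eq by lra; nra. }
    apply Rle_trans with ((1 + m) * (16 * (m * L) ^ 2))%R.
    - apply Rmult_le_compat; trivial; apply Cmod_ge_0.
    - replace (32 * (1 + m) * m ^ 2 * (/ s * / t))%R
        with ((1 + m) * (16 * (m ^ 2 * (2 * (/ s * / t)))))%R by ring.
      rewrite Rpow_mult_distr.
      repeat apply Rmult_le_compat_l; try lra; [nra|].
      eapply Rle_trans; [|apply Hs2]; simpl; rewrite Rmult_1_r.
      apply Rmult_le_compat; lra. }
  eapply Rle_trans; [apply Cmod_triangle|].
  eapply Rle_trans; [apply Rplus_le_compat_r, Cmod_triangle|].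
  lra.
Qed.

Lemma ex_series_inv_consecutive : ex_series (fun n => (/ INR (S n) * / INR (S (S n)))%R).
Proof.
  exists 1%R.
  change (is_lim_seq (sum_n (fun n => (/ INR (S n) * / INR (S (S n)))%R)) 1%R).
  apply is_lim_seq_ext with (fun n => (1 - / INR (S (S n)))%R).
  - intros n; induction n as [|n IH].
    + rewrite sum_O; simpl; field.
    + rewrite sum_Sn, <- IH; unfold plus; cbn -[INR].
      rewrite !S_INR; generalize (pos_INR n); intros; field; lra.
  - replace (Finite 1) with (Finite (1 - 0)) by (f_equal; ring).
    apply is_lim_seq_minus'; [apply is_lim_seq_const|].
    replace (Finite 0) with (Rbar_inv p_infty) by reflexivity.
    apply is_lim_seq_inv; [|discriminate].
    apply -> (is_lim_seq_incr_1 (fun n => INR (S n))).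
    apply -> (is_lim_seq_incr_1 INR); apply is_lim_seq_INR.
Qed.

Lemma ex_series_rgauss_err (z : C) : ex_series (fun n => Cmod (rgauss_err z n)).
Proof.
  destruct (INR_unbounded (2 * Cmod z)) as [N HN].
  apply (ex_series_incr_n _ N).
  set (K := (Cmod z + Cmod z ^ 2 + 32 * (1 + Cmod z) * Cmod z ^ 2)%R).
  apply (@ex_series_le R_AbsRing R_CompleteNormedModule)
    with (fun n => (K * (/ INR (S (N + n)) * / INR (S (S (N + n)))))%R).
  - intros n; change (Rabs (Cmod (rgauss_err z (N + n)))
                      <= K * (/ INR (S (N + n)) * / INR (S (S (N + n)))))%R.
    rewrite Rabs_pos_eq by apply Cmod_ge_0.
    apply Cmod_rgauss_err_le.
    rewrite S_INR, plus_INR; generalize (pos_INR n); lra.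
  - apply (ex_series_scal (V := R_NormedModule) K
      (fun n => (/ INR (S (N + n)) * / INR (S (S (N + n))))%R)).
    apply (ex_series_incr_n (fun n => (/ INR (S n) * / INR (S (S n)))%R) N).
    apply ex_series_inv_consecutive.
Qed.

Lemma rGamma_lim (z : C) : Cis_lim_seq (rgauss z) (rGamma z).
Proof.
  destruct (Cprod_converges (fun n => rgauss z (S n)) (rgauss_err z)
              (ex_series_rgauss_err z) (rgauss_S z)) as [l [H1 H2]].
  assert (H : Cis_lim_seq (rgauss z) l) by (split; now apply is_lim_seq_incr_1).
  unfold rGamma; now rewrite (Clim_seq_correct _ _ H).
Qed.

Lemma gamma_finite_neq (z : C) (k : nat) : gamma_finite z -> z + #k <> 0.
Proof.
  intros Hz H; apply (Hz k); rewrite RtoC_opp.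
  replace z with (z + #k - #k) by ring; rewrite H; ring.
Qed.

Lemma poch_neq_0 (z : C) (n : nat) : gamma_finite z -> poch z n <> 0.
Proof.
  intros Hz; induction n as [|n IH]; simpl; [apply C1_nz|].
  apply Cmult_neq_0; [exact IH | now apply gamma_finite_neq].
Qed.

Lemma rgauss_neq_0 (z : C) (n : nat) : gamma_finite z -> rgauss z n <> 0.
Proof.
  intros Hz H; apply (poch_neq_0 z (S n) Hz).
  replace (poch z (S n)) with (rgauss z n * (#(fact n) * Crpow (INR n) z)).
  - rewrite H; ring.
  - unfold rgauss; field; split; [apply Crpow_neq_0 | apply RtoC_fact_neq_0].
Qed.

Lemma rGamma_neq_0 (z : C) : gamma_finite z -> rGamma z <> 0.
Proof.
  intros Hz.
  apply (Cprod_lim_neq_0 (fun n => rgauss z (S n)) (rgauss_err z)).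
  - apply ex_series_rgauss_err.
  - apply rgauss_S.
  - intros n; now apply rgauss_neq_0.
  - apply Cis_lim_seq_S, rGamma_lim.
Qed.

Lemma CGamma_eq_inv_rGamma (z : C) : gamma_finite z -> CGamma z = / rGamma z.
Proof.
  intros Hz; apply Clim_seq_correct.
  apply Cis_lim_seq_ext with (fun n => / rgauss z n).
  - intros n; unfold gauss_seq, rgauss; field; repeat split.
    + now apply poch_neq_0.
    + apply Crpow_neq_0.
    + apply RtoC_fact_neq_0.
  - apply Cis_lim_seq_inv; [now apply rGamma_neq_0 | apply rGamma_lim].
Qed.

Lemma poch_S_l (z : C) (n : nat) : poch z (S n) = z * poch (z + 1) n.
Proof.
  induction n as [|n IH]; [simpl; ring|].
  change (poch z (S (S n))) with (poch z (S n) * (z + #(S n))).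
  rewrite IH, RtoC_S; simpl; ring.
Qed.

Lemma Cis_lim_seq_inv_INR : Cis_lim_seq (fun n => / #n) 0.
Proof.
  apply Cis_lim_seq_ext_loc with (fun n => RtoC (/ INR n)) 1%nat.
  - intros [|n] Hn; [lia|]; apply RtoC_inv, not_0_INR; lia.
  - split; simpl; [|apply is_lim_seq_const].
    replace (Finite 0) with (Rbar_inv p_infty) by reflexivity.
    apply is_lim_seq_inv; [apply is_lim_seq_INR | discriminate].
Qed.

(** At finite index the quotients at z and z + 1 agree up to the exact factor 1 + (z+1)/n, which
    tends to 1. The relation holds for all z, poles of Gamma included. *)
Lemma rGamma_S (z : C) : rGamma z = z * rGamma (z + 1).
Proof.
  assert (H : Cis_lim_seq (fun n => rgauss z n * (1 + (z + 1) * / #n))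
                (rGamma z * (1 + (z + 1) * 0))).
  { apply Cis_lim_seq_mult; [apply rGamma_lim|].
    apply Cis_lim_seq_plus; [apply Cis_lim_seq_const|].
    apply Cis_lim_seq_scal, Cis_lim_seq_inv_INR. }
  replace (rGamma z * (1 + (z + 1) * 0)) with (rGamma z) in H by ring.
  apply (Cis_lim_seq_unique _ _ _ H).
  apply Cis_lim_seq_ext_loc with (fun n => z * rgauss (z + 1) n) 1%nat;
    [|apply Cis_lim_seq_scal, rGamma_lim].
  intros [|n] Hn; [lia|].
  unfold rgauss.
  assert (E : z * poch (z + 1) (S (S n)) = poch z (S (S n)) * (z + #(S n) + 1)).
  { rewrite <- poch_S_l; change (poch z (S (S (S n)))) with (poch z (S (S n)) * (z + #(S (S n)))).
    rewrite (RtoC_S (S n)); ring. }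
  unfold Cdiv; rewrite Cmult_assoc, E.
  rewrite Crpow_plus, Crpow_1 by (apply lt_0_INR; lia).
  field; repeat split; try apply Crpow_neq_0; try apply RtoC_fact_neq_0;
    apply RtoC_S_neq_0.
Qed.

Lemma rGamma_poch (z : C) (n : nat) : rGamma z = poch z n * rGamma (z + #n).
Proof.
  induction n as [|n IH]; simpl poch.
  - simpl INR; rewrite Cplus_0_r; ring.
  - rewrite IH, (rGamma_S (z + #n)), RtoC_S, Cplus_assoc; ring.
Qed.

(** * The regularised Gauss function at 1/2 *)

(** As 1/(Gamma(c) (c)_n) = 1/Gamma(c+n), these are the terms of 2F1(a,b;c;1/2)/Gamma(c), written so
    that c may be a non-positive integer. *)
Definition hyp_term (a b c : C) (n : nat) : C :=
  poch a n * poch b n * rGamma (c + #n) * (Cnpow (RtoC (/ 2)) n / #(fact n)).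

Definition hyp (a b c : C) : C := Clim_seq (sum_n (hyp_term a b c)).

Lemma RtoC_half : RtoC (/ 2) = / 2.
Proof. apply RtoC_inv; lra. Qed.

Lemma C2_neq_0 : RtoC 2 <> 0.
Proof. intros H; apply RtoC_inj in H; lra. Qed.

Ltac Cneq0 :=
  repeat split; try assumption;
  first [ apply RtoC_fact_neq_0 | apply RtoC_S_neq_0 | apply C2_neq_0 | apply Crpow_neq_0
        | rewrite <- RtoC_S; apply RtoC_S_neq_0 ].

Lemma hyp_term_S (a b c : C) (n : nat) :
  (c + #n) * hyp_term a b c (S n) * (2 * #(S n))
  = hyp_term a b c n * ((a + #n) * (b + #n)).
Proof.
  unfold hyp_term; rewrite RtoC_fact_S, (rGamma_S (c + #n)), RtoC_half.
  replace (c + #(S n)) with (c + #n + 1) by (rewrite RtoC_S; ring).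
  simpl poch; simpl Cnpow; field.
  Cneq0.
Qed.

Lemma Cmod_plus_INR_le (z : C) (n : nat) : (Cmod (z + #n) <= Cmod z + INR n)%R.
Proof.
  eapply Rle_trans; [apply Cmod_triangle|].
  rewrite Cmod_R, Rabs_pos_eq by apply pos_INR; lra.
Qed.

Lemma Cmod_plus_INR_ge (z : C) (n : nat) : (INR n - Cmod z <= Cmod (z + #n))%R.
Proof.
  assert (H := Cmod_triangle (z + #n) (- z)).
  replace (z + #n + - z) with #n in H by ring.
  rewrite Cmod_R, Rabs_pos_eq, Cmod_opp in H by apply pos_INR; lra.
Qed.

Lemma hyp_term_abs_conv (a b c : C) : ex_series (fun n => Cmod (hyp_term a b c n)).
Proof.
  (* The ratio of consecutive terms tends to 1/2. Beyond this [N] each parameter is at most n/10 in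
     modulus, so the ratio is at most 1.21/1.8, which is below 3/4. *)
  destruct (INR_unbounded (10 * (Cmod a + Cmod b + Cmod c + 1))) as [N HN].
  apply ex_series_ratio with (3 / 4)%R N; [lra | intros; apply Cmod_ge_0|].
  intros n Hn; apply le_INR in Hn.
  assert (H := f_equal Cmod (hyp_term_S a b c n)).
  rewrite !Cmod_mult, (Cmod_R 2), (Cmod_R (INR (S n))), (Rabs_pos_eq 2),
    (Rabs_pos_eq (INR (S n))) in H by (lra || apply pos_INR).
  assert (Ha := Cmod_plus_INR_le a n); assert (Hb := Cmod_plus_INR_le b n).
  assert (Hc := Cmod_plus_INR_ge c n).
  generalize (Cmod_ge_0 a) (Cmod_ge_0 b) (Cmod_ge_0 c)
    (Cmod_ge_0 (a + #n)) (Cmod_ge_0 (b + #n)); intros.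
  rewrite S_INR in H; set (x := INR n) in *.
  assert (Hab : (Cmod (a + RtoC x) * Cmod (b + RtoC x) <= 1.1 * x * (1.1 * x))%R)
    by (apply Rmult_le_compat; lra).
  assert (Hcx : (0.9 * x * (2 * x) <= Cmod (c + RtoC x) * (2 * (x + 1)))%R)
    by (apply Rmult_le_compat; lra).
  set (X := (Cmod (c + RtoC x) * (2 * (x + 1)))%R) in *.
  set (Y := (Cmod (a + RtoC x) * Cmod (b + RtoC x))%R) in *.
  assert (0 < X)%R by nra.
  apply Rmult_le_reg_r with X; [assumption|].
  replace (Cmod (hyp_term a b c (S n)) * X)%R
    with (Cmod (c + RtoC x) * Cmod (hyp_term a b c (S n)) * (2 * (x + 1)))%R
    by (unfold X; ring).
  rewrite H, (Rmult_comm (3 / 4)), Rmult_assoc.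
  apply Rmult_le_compat_l; [apply Cmod_ge_0 | nra].
Qed.

Lemma hyp_series (a b c : C) : Cis_series (hyp_term a b c) (hyp a b c).
Proof.
  destruct (ex_Cis_series_abs _ (hyp_term_abs_conv a b c)) as [l Hl].
  unfold hyp; now rewrite (Clim_seq_correct _ _ Hl).
Qed.

(** True term by term: with 1/Gamma(c+n) = (c+n)/Gamma(c+n+1), the right side carries the factor
    (c+n) - (c-a) = a+n, and (a)_n (a+n) = a (a+1)_n. *)
Lemma hyp_raise_a (a b c : C) :
  a * hyp (a + 1) b (c + 1) = hyp a b c - (c - a) * hyp a b (c + 1).
Proof.
  apply (Cis_lim_seq_unique _ _ _
    (Cis_series_scal a _ _ (hyp_series (a + 1) b (c + 1)))).
  replace (hyp a b c - (c - a) * hyp a b (c + 1))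
    with (hyp a b c + (- (c - a)) * hyp a b (c + 1)) by ring.
  assert (K := Cis_series_plus _ _ _ _ (hyp_series a b c)
                 (Cis_series_scal (- (c - a)) _ _ (hyp_series a b (c + 1)))).
  apply Cis_series_ext with (2 := K); intros n; unfold hyp_term.
  rewrite (rGamma_S (c + #n)).
  replace (c + 1 + #n) with (c + #n + 1) by ring.
  transitivity (poch a n * (a + #n) * poch b n * rGamma (c + #n + 1)
                * (Cnpow (RtoC (/ 2)) n / #(fact n))); [ring|].
  change (poch a n * (a + #n)) with (poch a (S n)); rewrite poch_S_l; ring.
Qed.

Lemma poch_pred (b : C) (n : nat) :
  poch (b - 1) (S n) = poch b (S n) - #(S n) * poch b n.
Proof.
  rewrite poch_S_l; replace (b - 1 + 1) with b by ring.
  simpl poch; rewrite RtoC_S; ring.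
Qed.

(** Splitting (b-1)_n = (b)_n - n (b)_(n-1) leaves a second series which, shifted by one index, has
    the factor a+n = (c+n) - (c-a). The factor 1/2 is the argument of the series, released by the
    shift. *)
Lemma hyp_lower_b (a b c : C) :
  hyp a (b - 1) c = / 2 * hyp a b c + / 2 * (c - a) * hyp a b (c + 1).
Proof.
  apply (Cis_lim_seq_unique _ _ _ (hyp_series a (b - 1) c)).
  (* At n = 0 the default value of [pred] is harmless, since the factor n vanishes. *)
  set (s n := #n * poch a n * poch b (pred n) * rGamma (c + #n)
              * (Cnpow (RtoC (/ 2)) n / #(fact n))).
  assert (Hs : Cis_series s (/ 2 * hyp a b c - / 2 * (c - a) * hyp a b (c + 1))).
  { assert (K := Cis_series_plus _ _ _ _ (Cis_series_scal (/ 2) _ _ (hyp_series a b c))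
      (Cis_series_scal (- / 2 * (c - a)) _ _ (hyp_series a b (c + 1)))).
    replace (/ 2 * hyp a b c - / 2 * (c - a) * hyp a b (c + 1))
      with (s 0%nat + (/ 2 * hyp a b c + - / 2 * (c - a) * hyp a b (c + 1)))
      by (unfold s; simpl INR; ring).
    apply Cis_series_incr, Cis_series_ext with (2 := K).
    intros n; unfold s, hyp_term; simpl pred.
    rewrite RtoC_fact_S, (rGamma_S (c + #n)), RtoC_half.
    replace (c + 1 + #n) with (c + #n + 1) by ring.
    replace (c + #(S n)) with (c + #n + 1) by (rewrite RtoC_S; ring).
    simpl poch; simpl Cnpow; field.
    Cneq0. }
  replace (/ 2 * hyp a b c + / 2 * (c - a) * hyp a b (c + 1))
    with (hyp a b c + - (1) * (/ 2 * hyp a b c - / 2 * (c - a) * hyp a b (c + 1)))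
    by (field; apply C2_neq_0).
  assert (K := Cis_series_plus _ _ _ _ (hyp_series a b c) (Cis_series_scal (- (1)) _ _ Hs)).
  apply Cis_series_ext with (2 := K); intros [|n]; unfold s, hyp_term.
  - simpl; ring.
  - rewrite poch_pred; simpl pred; ring.
Qed.

(* Summation by parts: the termwise difference of the two sides is the increment of
   [g n = -2 n w_n rGamma (c + n + 1)], where [w_n] is the term without its Gamma factor. *)
Lemma hyp_shift_c2 (a c : C) :
  hyp a (1 - a) c = (c + 1 - a) * (c + a) * hyp a (1 - a) (c + 2).
Proof.
  set (w n := poch a n * poch (1 - a) n * (Cnpow (RtoC (/ 2)) n / #(fact n))).
  set (g n := -2 * #n * w n * rGamma (c + #n + 1)).
  assert (Hg : Cis_lim_seq g 0).
  { assert (K := Cis_lim_seq_scal (-2) _ _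
      (Cis_series_lim_0 _ _ (hyp_series a (1 - a) c))).
    (* For large n, g n is -2 times the n-th term of the series divided by 1 + c/n, so it tends to 0
       along with the terms. *)
    assert (H1 : Cis_lim_seq (fun n => / (1 + c * / #n)) (/ (1 + c * 0))).
    { apply Cis_lim_seq_inv; [rewrite Cmult_0_r, Cplus_0_r; apply C1_nz|].
      apply Cis_lim_seq_plus; [apply Cis_lim_seq_const|].
      apply Cis_lim_seq_scal, Cis_lim_seq_inv_INR. }
    assert (H := Cis_lim_seq_mult _ _ _ _ K H1).
    replace (-2 * 0 * / (1 + c * 0)) with (RtoC 0) in H by ring.
    destruct (INR_unbounded (Cmod c)) as [N HN].
    apply Cis_lim_seq_ext_loc with (2 := H) (N := S N).
    intros n Hn; unfold g, w, hyp_term; rewrite (rGamma_S (c + #n)).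
    assert (Hn0 : #n <> 0) by (intros E; apply RtoC_inj in E; apply (not_0_INR n); [lia|exact E]).
    assert (Hcn : c + #n <> 0).
    { apply Cmod_gt_0; eapply Rlt_le_trans; [|apply Cmod_plus_INR_ge].
      apply Rlt_le_trans with (INR N - Cmod c)%R; [lra|].
      apply Rplus_le_compat_r, le_INR; lia. }
    replace (1 + c * / #n) with ((c + #n) / #n) by (field; exact Hn0).
    field; Cneq0. }
  assert (Htel := Cis_series_telescope g Hg).
  replace (- g 0%nat) with (RtoC 0) in Htel by (unfold g; simpl INR; ring).
  assert (K := Cis_series_plus _ _ _ _ Htel
    (Cis_series_scal ((c + 1 - a) * (c + a)) _ _ (hyp_series a (1 - a) (c + 2)))).
  rewrite Cplus_0_l in K.
  apply (Cis_lim_seq_unique _ _ _ (hyp_series a (1 - a) c)).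
  apply Cis_series_ext with (2 := K); intros n.
  unfold g, w, hyp_term.
  rewrite (rGamma_S (c + #n)), (rGamma_S (c + #n + 1)).
  replace (c + #n + 1 + 1) with (c + 2 + #n) by ring.
  replace (c + #(S n) + 1) with (c + 2 + #n) by (rewrite RtoC_S; ring).
  rewrite RtoC_fact_S, RtoC_half; simpl poch; simpl Cnpow; rewrite RtoC_S.
  field; Cneq0.
Qed.

(** Each factor c+a+2k is 2((c+a)/2+k). The factors c-a+2k+1 are every other factor of (c-a)_(2n);
    multiplying by ((c-a)/2)_n supplies the missing ones, and the powers of 2 cancel. *)
Lemma hyp_shift_c2_iter (a c : C) (n : nat) :
  hyp a (1 - a) c * poch ((c - a) / 2) n
  = poch (c - a) (2 * n) * poch ((c + a) / 2) n * hyp a (1 - a) (c + #(2 * n)).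
Proof.
  induction n as [|n IH].
  - simpl; rewrite Cplus_0_r; ring.
  - replace (2 * S n)%nat with (S (S (2 * n))) by lia.
    change (poch (c - a) (S (S (2 * n))))
      with (poch (c - a) (2 * n) * (c - a + #(2 * n)) * (c - a + #(S (2 * n)))).
    change (poch ((c - a) / 2) (S n)) with (poch ((c - a) / 2) n * ((c - a) / 2 + #n)).
    change (poch ((c + a) / 2) (S n)) with (poch ((c + a) / 2) n * ((c + a) / 2 + #n)).
    rewrite Cmult_assoc, IH, (hyp_shift_c2 a (c + #(2 * n))).
    rewrite !RtoC_S, mult_INR, RtoC_mult.
    replace (c + (RtoC (INR 2) * #n + 1 + 1)) with (c + RtoC (INR 2) * #n + 2) by ring.
    change (INR 2) with 2%R; field; apply C2_neq_0.
Qed.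

(** * The regularised series for large c *)

Lemma Re_le_Cmod_plus_INR (c : C) (n : nat) : (Re c + INR n <= Cmod (c + #n))%R.
Proof.
  eapply Rle_trans; [|apply Rabs_fst_le_Cmod].
  eapply Rle_trans; [|apply Rle_abs]; apply Rle_refl.
Qed.

Lemma gamma_finite_Re_pos (c : C) : (0 < Re c)%R -> gamma_finite c.
Proof.
  intros Hc k H; rewrite H in Hc; simpl in Hc; generalize (pos_INR k); lra.
Qed.

(** Each |c+k| is at least k+1, and the factor k = 0 is at least M+1; this one large factor supplies
    the decay in M. *)
Lemma Cmod_poch_ge (c : C) (M n : nat) :
  (INR M + 1 <= Re c -> (INR M + 1) * INR (fact (S n)) <= Cmod (poch c (S n)))%R.
Proof.
  intros Hc.
  assert (HM := pos_INR M).
  induction n as [|n IH].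
  - simpl poch; simpl fact.
    rewrite Cmult_1_l; eapply Rle_trans; [|apply (Re_le_Cmod_plus_INR c 0)]; simpl; lra.
  - change (poch c (S (S n))) with (poch c (S n) * (c + #(S n))).
    rewrite Cmod_mult, fact_simpl, mult_INR, (Rmult_comm (INR (S (S n)))), <- Rmult_assoc.
    apply Rmult_le_compat; trivial; [| apply pos_INR |].
    + apply Rmult_le_pos; [lra | apply pos_INR].
    + eapply Rle_trans; [|apply Re_le_Cmod_plus_INR]; rewrite (S_INR (S n)); lra.
Qed.

Lemma poch_1 (n : nat) : poch 1 n = #(fact n).
Proof.
  induction n as [|n IH]; [reflexivity|].
  rewrite RtoC_fact_S, RtoC_S; simpl poch; rewrite IH; ring.
Qed.

(** The tail is compared with the fixed series at c = 1: relative to 1/Gamma(c), each term beyond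
    the first is smaller by the factor M+1 than the corresponding one at c = 1, since |(c)_n| >=
    (M+1) (1)_n for n >= 1. Hence [K] depends on a and b only. *)
Lemma hyp_leading_term (a b : C) : exists K : R, forall (c : C) (M : nat),
  (INR M + 1 <= Re c)%R ->
  (Cmod (hyp a b c - rGamma c) <= Cmod (rGamma c) * (K * / INR (S M)))%R.
Proof.
  exists (Series (fun n => Cmod (hyp_term a b 1 (S n))) / Cmod (rGamma 1))%R.
  intros c M Hc.
  assert (HM := pos_INR M).
  assert (H1 : (0 < Cmod (rGamma 1))%R).
  { apply Cmod_gt_0, rGamma_neq_0, gamma_finite_Re_pos; simpl; lra. }
  assert (Hex : ex_series (fun n => Cmod (hyp_term a b 1 (S n)))).
  { apply -> (ex_series_incr_1 (fun n => Cmod (hyp_term a b 1 n))).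
    apply hyp_term_abs_conv. }
  set (q := (Cmod (rGamma c) / (Cmod (rGamma 1) * INR (S M)))%R).
  assert (Htail : Cis_series (fun n => hyp_term a b c (S n)) (hyp a b c - rGamma c)).
  { assert (K := Cis_lim_seq_plus _ _ _ _
      (Cis_lim_seq_const (- rGamma c)) (Cis_lim_seq_S _ _ (hyp_series a b c))).
    replace (hyp a b c - rGamma c) with (- rGamma c + hyp a b c) by ring.
    apply Cis_lim_seq_ext with (2 := K); intros n; rewrite Csum_shift.
    unfold hyp_term at 1; simpl; rewrite Cplus_0_r; Cfield; apply C1_nz. }
  replace (Cmod (rGamma c) * _)%R
    with (Series (fun n => (q * Cmod (hyp_term a b 1 (S n)))%R)).
  2: { rewrite Series_scal_l; unfold q; rewrite S_INR; field; lra. }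
  apply Cmod_series_le with (1 := Htail).
  2: exact (ex_series_scal (V := R_NormedModule) q _ Hex).
  intros n; unfold hyp_term; rewrite !Cmod_mult.
  assert (Hp := Cmod_poch_ge c M n Hc).
  assert (Ec := f_equal Cmod (rGamma_poch c (S n))).
  assert (E1 := f_equal Cmod (rGamma_poch 1 (S n))).
  rewrite Cmod_mult in Ec; rewrite poch_1, Cmod_mult, Cmod_R, Rabs_pos_eq in E1 by apply pos_INR.
  set (T := Cmod (_ / _)); set (G := Cmod (rGamma (c + #(S n)))) in *;
    set (G1 := Cmod (rGamma (1 + #(S n)))) in *.
  assert (HG : (0 <= G)%R) by apply Cmod_ge_0.
  assert (HG1 : (0 <= G1)%R) by apply Cmod_ge_0.
  assert (Hq : (G <= q * G1)%R).
  { unfold q; apply Rmult_le_reg_r with (Cmod (rGamma 1) * INR (S M))%R.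
    - apply Rmult_lt_0_compat; [exact H1 | rewrite S_INR; lra].
    - replace (Cmod (rGamma c) / (Cmod (rGamma 1) * INR (S M)) * G1
               * (Cmod (rGamma 1) * INR (S M)))%R with (Cmod (rGamma c) * G1)%R
        by (rewrite S_INR; field; lra).
      rewrite Ec, E1, S_INR.
      replace (G * (INR (fact (S n)) * G1 * (INR M + 1)))%R
        with ((INR M + 1) * INR (fact (S n)) * (G * G1))%R by ring.
      rewrite (Rmult_assoc (Cmod (poch c (S n)))).
      apply Rmult_le_compat_r; [now apply Rmult_le_pos | exact Hp]. }
  replace (q * (Cmod (poch a (S n)) * Cmod (poch b (S n)) * G1 * T))%R
    with (Cmod (poch a (S n)) * Cmod (poch b (S n)) * (q * G1) * T)%R by ring.
  apply Rmult_le_compat_r; [apply Cmod_ge_0|].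
  apply Rmult_le_compat_l; [|exact Hq].
  apply Rmult_le_pos; apply Cmod_ge_0.
Qed.

Lemma hyp_div_rGamma_lim (a b c : C) :
  (1 <= Re c)%R ->
  Cis_lim_seq (fun n => hyp a b (c + #(S (S (2 * n)))) / rGamma (c + #(S (S (2 * n))))) 1.
Proof.
  intros Hc.
  destruct (hyp_leading_term a b) as [K HK].
  set (d n := hyp a b (c + #(S (S (2 * n)))) / rGamma (c + #(S (S (2 * n)))) - 1).
  assert (Hd : Cis_lim_seq d 0).
  { apply Cis_lim_seq_0_le with (fun n => (K * / INR (S (S (S (2 * n)))))%R).
    - intros n; unfold d; set (c' := c + #(S (S (2 * n)))).
      assert (Hc' : (INR (S (S (2 * n))) + 1 <= Re c')%R) 
        by (change (Re c') with (Re c + INR (S (S (2 * n))))%R; lra).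
      assert (Hnz : rGamma c' <> 0).
      { apply rGamma_neq_0, gamma_finite_Re_pos; generalize (pos_INR (S (S (2 * n)))); lra. }
      replace (hyp a b c' / rGamma c' - 1) with ((hyp a b c' - rGamma c') / rGamma c')
        by (field; exact Hnz).
      rewrite Cmod_div by exact Hnz.
      apply Rle_div_l; [now apply Cmod_gt_0|].
      rewrite Rmult_comm; now apply HK.
    - replace (Finite 0) with (Finite (K * 0)) by (f_equal; ring).
      apply is_lim_seq_mult'; [apply is_lim_seq_const|].
      apply (is_lim_seq_subseq (fun n => (/ INR n)%R) 0%R (fun n => S (S (S (2 * n))))).
      + apply eventually_subseq; intros; lia.
      + replace (Finite 0) with (Rbar_inv p_infty) by reflexivity.
        apply is_lim_seq_inv; [apply is_lim_seq_INR | discriminate]. }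
  assert (H := Cis_lim_seq_plus _ _ _ _ (Cis_lim_seq_const 1) Hd).
  rewrite Cplus_0_r in H; apply Cis_lim_seq_ext with (2 := H).
  intros n; unfold d; ring.
Qed.

Lemma is_lim_seq_half_ratio : is_lim_seq (fun n => (INR n / INR (S (2 * n)))%R) (/ 2)%R.
Proof.
  apply is_lim_seq_ext with (fun n => (/ 2 - / 2 * / INR (S (2 * n)))%R).
  - intros n; rewrite S_INR, mult_INR; change (INR 2) with 2%R.
    generalize (pos_INR n); intros; field; lra.
  - replace (Finite (/ 2)) with (Finite (/ 2 - / 2 * 0)) by (f_equal; ring).
    apply is_lim_seq_minus'; [apply is_lim_seq_const|].
    apply is_lim_seq_mult'; [apply is_lim_seq_const|].
    apply (is_lim_seq_subseq (fun n => (/ INR n)%R) 0%R (fun n => S (2 * n))).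
    + apply eventually_subseq; intros; lia.
    + replace (Finite 0) with (Rbar_inv p_infty) by reflexivity.
      apply is_lim_seq_inv; [apply is_lim_seq_INR | discriminate].
Qed.

(** Multiplying by the n-th quotient for 1/Gamma((c-a)/2) and applying the iterated recurrence n+1
    times produces the quotients at c-a, c and (c+a)/2. The condition on Re c keeps 1/Gamma(c) away
    from 0 and starts the asymptotics. *)
Lemma hyp_bailey_Re_ge_1 (a c : C) :
  (1 <= Re c)%R ->
  hyp a (1 - a) c * rGamma ((c - a) / 2)
  = Crpow 2 (- a) * rGamma (c - a) * rGamma ((c + a) / 2).
Proof.
  intros Hc.
  assert (Hfin : gamma_finite c) by (apply gamma_finite_Re_pos; lra).
  assert (Hrc := rGamma_neq_0 c Hfin).
  assert (Hodd : filterlim (fun n => S (2 * n)) eventually eventually)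
    by (apply eventually_subseq; intros; lia).
  assert (L := Cis_lim_seq_scal (hyp a (1 - a) c) _ _ (rGamma_lim ((c - a) / 2))).
  apply (Cis_lim_seq_unique _ _ _ L).
  assert (R1 := Cis_lim_seq_subseq _ _ _ Hodd (rGamma_lim (c - a))).
  assert (R2 := Cis_lim_seq_scal (rGamma c) _ _
    (Cis_lim_seq_inv _ _ Hrc (Cis_lim_seq_subseq _ _ _ Hodd (rGamma_lim c)))).
  assert (R3 := hyp_div_rGamma_lim a (1 - a) c Hc).
  assert (R4 := rGamma_lim ((c + a) / 2)).
  (* The powers left over from Gauss' quotients are n^a from the half arguments and (2n+1)^(-a) from
     c-a and c; together they tend to 2^(-a). *)
  assert (R5 := Cis_lim_seq_Crpow _ (/ 2) a ltac:(lra) is_lim_seq_half_ratio).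
  assert (R := Cis_lim_seq_mult _ _ _ _ (Cis_lim_seq_mult _ _ _ _
    (Cis_lim_seq_mult _ _ _ _ (Cis_lim_seq_mult _ _ _ _ R1 R2) R3) R4) R5).
  replace (Crpow 2 (- a) * rGamma (c - a) * rGamma ((c + a) / 2))
    with (rGamma (c - a) * (rGamma c * / rGamma c) * 1 * rGamma ((c + a) / 2) * Crpow (/ 2) a)
    by (rewrite Crpow_inv by lra; field; exact Hrc).
  apply Cis_lim_seq_ext_loc with (2 := R) (N := 1%nat).
  intros n Hn.
  assert (Hn0 : (0 < INR n)%R) by (apply lt_0_INR; lia).
  assert (Hm0 : (0 < INR (S (2 * n)))%R) by (apply lt_0_INR; lia).
  assert (Hit := hyp_shift_c2_iter a c (S n)).
  replace (2 * S n)%nat with (S (S (2 * n))) in Hit by lia.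
  assert (EG := rGamma_poch c (S (S (2 * n)))).
  assert (HG : rGamma (c + #(S (S (2 * n)))) <> 0).
  { intros H; apply Hrc; rewrite EG, H; ring. }
  assert (Hp := poch_neq_0 c (S (S (2 * n))) Hfin).
  assert (E1 : Crpow (INR (S (2 * n))) c
               = Crpow (INR (S (2 * n))) (c - a) * Crpow (INR (S (2 * n))) a)
    by (rewrite <- Crpow_plus; f_equal; ring).
  assert (E2 : Crpow (INR n) ((c + a) / 2)
     = Crpow (INR n) ((c - a) / 2) * (Crpow (INR n / INR (S (2 * n))) a * Crpow (INR (S (2 * n))) a)).
  { rewrite <- Crpow_mult; trivial; [|now apply Rdiv_lt_0_compat].
    replace (INR n / INR (S (2 * n)) * INR (S (2 * n)))%R with (INR n) by (field; lra).
    rewrite <- Crpow_plus; f_equal; field; apply C2_neq_0. }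
  unfold rgauss.
  symmetry; transitivity (hyp a (1 - a) c * poch ((c - a) / 2) (S n)
                          / (#(fact n) * Crpow (INR n) ((c - a) / 2)));
    [unfold Cdiv; ring|].
  rewrite Hit, EG, E1, E2.
  field; Cneq0.
Qed.

(** The recurrence carries the identity from x+2 down to x. Neither side divides by anything
    depending on x, so no point has to be avoided. *)
Lemma hyp_bailey (a c : C) :
  hyp a (1 - a) c * rGamma ((c - a) / 2)
  = Crpow 2 (- a) * rGamma (c - a) * rGamma ((c + a) / 2).
Proof.
  assert (Hind : forall (N : nat) (x : C), (1 <= Re x + INR N)%R ->
    hyp a (1 - a) x * rGamma ((x - a) / 2)
    = Crpow 2 (- a) * rGamma (x - a) * rGamma ((x + a) / 2)).
  { intros N; induction N as [|N IH]; intros x Hx.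
    - apply hyp_bailey_Re_ge_1; simpl in Hx; lra.
    - assert (IHx := IH (x + 2)).
      rewrite hyp_shift_c2, (rGamma_S ((x - a) / 2)), (rGamma_S ((x + a) / 2)),
        (rGamma_S (x - a)), (rGamma_S (x - a + 1)).
      replace ((x - a) / 2 + 1) with ((x + 2 - a) / 2) by (field; apply C2_neq_0).
      replace ((x + a) / 2 + 1) with ((x + 2 + a) / 2) by (field; apply C2_neq_0).
      replace (x - a + 1 + 1) with (x + 2 - a) by ring.
      transitivity ((x + 1 - a) * (x + a) * ((x - a) / 2)
        * (hyp a (1 - a) (x + 2) * rGamma ((x + 2 - a) / 2))); [ring|].
      rewrite IHx; [field; apply C2_neq_0|].
      change (Re (x + 2)) with (Re x + 2)%R; rewrite S_INR in Hx; lra. }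
  destruct (INR_unbounded (1 - Re c)) as [N HN]; apply (Hind N); lra.
Qed.

(** * Bailey's theorem with an integer shift *)

Lemma Cbinom_0 (i : nat) : Cbinom i 0 = 1.
Proof.
  unfold Cbinom, Binomial.C; rewrite Nat.sub_0_r; simpl.
  apply f_equal; field; apply INR_fact_neq_0.
Qed.

Lemma Cbinom_diag (i : nat) : Cbinom i i = 1.
Proof.
  unfold Cbinom, Binomial.C; rewrite Nat.sub_diag; simpl.
  apply f_equal; field; apply INR_fact_neq_0.
Qed.

Lemma Cbinom_pascal (i r : nat) :
  (r < i)%nat -> Cbinom (S i) (S r) = Cbinom i r + Cbinom i (S r).
Proof.
  intros H; unfold Cbinom; rewrite <- RtoC_plus; now rewrite pascal.
Qed.

(** The end terms are split off because [Binomial.C i r] is not 0 for r > i, its subtraction being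
    truncated; Pascal's rule is thus available only at interior indices. *)
Lemma sum_Cbinom_S (x : nat -> C) (i : nat) :
  sum_n (fun r => Cbinom (S i) r * x r) (S i)
  = sum_n (fun r => Cbinom i r * x r) i + sum_n (fun r => Cbinom i r * x (S r)) i.
Proof.
  destruct i as [|j].
  - rewrite Csum_S, !Csum_O, !Cbinom_0, Cbinom_diag; Cring.
  - rewrite (Csum_shift _ (S j)), Csum_S, (Csum_shift _ j), (Csum_S _ j).
    rewrite !Cbinom_0, !Cbinom_diag.
    rewrite (sum_n_ext_loc (fun k => Cbinom (S (S j)) (S k) * x (S k))
      (fun k => Cbinom (S j) k * x (S k) + Cbinom (S j) (S k) * x (S k))).
    + rewrite Csum_plus; Cring.
    + intros n Hn; rewrite Cbinom_pascal by lia; Cring.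
Qed.

(** [hyp_lower_b] expresses the case i+1 by the case i at d and d+1. Moving from d to d+1 replaces r
    by r+1 in the summand, so the two sums merge by Pascal's rule; each step contributes one factor
    1/2. *)
Lemma hyp_bailey_lower (i : nat) (alpha d : C) :
  (forall r, (r <= i)%nat -> rGamma ((d - alpha + #r) / 2) <> 0) ->
  hyp alpha (1 - alpha - #i) d
  = Crpow 2 (- alpha - #i) * rGamma (d - alpha)
    * sum_n (fun r => Cbinom i r
        * (rGamma ((d + alpha + #r) / 2) / rGamma ((d - alpha + #r) / 2))) i.
Proof.
  revert d; induction i as [|i IH]; intros d Hd.
  - specialize (Hd 0%nat (le_n _)).
    rewrite Csum_O, Cbinom_0; simpl INR in *.
    replace (- alpha - 0) with (- alpha) by ring.
    replace (1 - alpha - 0) with (1 - alpha) by ring.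
    rewrite !Cplus_0_r in *.
    transitivity (hyp alpha (1 - alpha) d * rGamma ((d - alpha) / 2) / rGamma ((d - alpha) / 2));
      [field; exact Hd|].
    rewrite hyp_bailey; Cfield; exact Hd.
  - replace (1 - alpha - #(S i)) with (1 - alpha - #i - 1) by (rewrite RtoC_S; ring).
    rewrite hyp_lower_b, IH, IH, sum_Cbinom_S.
    2: { intros r Hr; replace (d + 1 - alpha + #r) with (d - alpha + #(S r))
           by (rewrite RtoC_S; ring); apply Hd; lia. }
    2: { intros r Hr; apply Hd; lia. }
    rewrite (sum_n_ext (fun r => Cbinom i r * (rGamma ((d + 1 + alpha + #r) / 2)
                                   / rGamma ((d + 1 - alpha + #r) / 2)))
      (fun r => Cbinom i r * (rGamma ((d + alpha + #(S r)) / 2)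
                              / rGamma ((d - alpha + #(S r)) / 2)))).
    2: { intros r.
         replace (d + 1 + alpha + #r) with (d + alpha + #(S r)) by (rewrite RtoC_S; ring).
         now replace (d + 1 - alpha + #r) with (d - alpha + #(S r)) by (rewrite RtoC_S; ring). }
    replace (- alpha - #i) with (- alpha - #(S i) + 1) by (rewrite RtoC_S; ring).
    rewrite Crpow_plus, Crpow_1 by lra.
    rewrite (rGamma_S (d - alpha)).
    replace (d + 1 - alpha) with (d - alpha + 1) by ring.
    Cfield; apply C2_neq_0.
Qed.

(** Raising the first parameter from alpha-1 to alpha keeps the second one, as 1-(alpha-1)+i =
    1-alpha+(i+1); hence the induction varies alpha and d together. Each step brings a factor
    alpha-1, and collecting these in (alpha-i)_i avoids dividing by them. *)
Lemma hyp_bailey_raise (i : nat) (alpha d : C) :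
  (forall r, (r <= i)%nat -> rGamma ((d - alpha + #r) / 2) <> 0) ->
  poch (alpha - #i) i * hyp alpha (1 - alpha + #i) d
  = Crpow 2 (#i - alpha) * rGamma (d - alpha)
    * sum_n (fun r => Cbinom i r
        * (Csign r * (rGamma ((d + alpha - 2 * #i + #r) / 2) / rGamma ((d - alpha + #r) / 2)))) i.
Proof.
  revert alpha d; induction i as [|i IH]; intros alpha d Hd.
  - specialize (Hd 0%nat (le_n _)).
    rewrite Csum_O, Cbinom_0; unfold Csign; simpl.
    simpl INR in *.
    replace (0 - alpha) with (- alpha) by ring.
    replace (d + alpha - 2 * 0 + 0) with (d + alpha) by ring.
    rewrite !Cplus_0_r in *.
    transitivity (hyp alpha (1 - alpha) d * rGamma ((d - alpha) / 2) / rGamma ((d - alpha) / 2));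
      [field; exact Hd|].
    rewrite hyp_bailey; Cfield; exact Hd.
  - set (b := 1 - (alpha - 1) + #i).
    assert (Hr := hyp_raise_a (alpha - 1) b (d - 1)).
    replace (alpha - 1 + 1) with alpha in Hr by ring.
    replace (d - 1 + 1) with d in Hr by ring.
    assert (I1 := IH (alpha - 1) (d - 1)); assert (I2 := IH (alpha - 1) d); fold b in I1, I2.
    set (x r := Csign r * (rGamma ((d + alpha - 2 * #(S i) + #r) / 2)
                           / rGamma ((d - alpha + #r) / 2))).
    (* The summand is x r at d-1 but -x(r+1) at d, the sign coming from [Csign]. The minus sign in
       [hyp_raise_a] then gives the sum that Pascal's rule needs. *)
    rewrite (sum_n_ext _ (fun r => Cbinom i r * x r)) in I1.
    2: { intros r; unfold x.
         replace (d - 1 + (alpha - 1) - 2 * #i + #r) with (d + alpha - 2 * #(S i) + #r)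
           by (rewrite RtoC_S; ring).
         now replace (d - 1 - (alpha - 1)) with (d - alpha) by ring. }
    rewrite (sum_n_ext _ (fun r => - (1) * (Cbinom i r * x (S r)))) in I2.
    2: { intros r; unfold x.
         replace (d + (alpha - 1) - 2 * #i + #r) with (d + alpha - 2 * #(S i) + #(S r))
           by (rewrite !RtoC_S; ring).
         replace (d - (alpha - 1) + #r) with (d - alpha + #(S r)) by (rewrite RtoC_S; ring).
         unfold Csign; simpl Cnpow; unfold Cdiv; Cring. }
    rewrite Csum_scal in I2.
    replace (1 - alpha + #(S i)) with b by (unfold b; rewrite RtoC_S; ring).
    change (sum_n _ (S i)) with (sum_n (fun r => Cbinom (S i) r * x r) (S i)).
    rewrite sum_Cbinom_S.
    change (poch (alpha - #(S i)) (S i))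
      with (poch (alpha - #(S i)) i * (alpha - #(S i) + #i)).
    replace (alpha - #(S i) + #i) with (alpha - 1) by (rewrite RtoC_S; ring).
    replace (alpha - #(S i)) with (alpha - 1 - #i) by (rewrite RtoC_S; ring).
    rewrite <- Cmult_assoc, Hr.
    transitivity (poch (alpha - 1 - #i) i * hyp (alpha - 1) b (d - 1)
      - (d - alpha) * (poch (alpha - 1 - #i) i * hyp (alpha - 1) b d)); [ring|].
    rewrite I1, I2.
    + replace (d - 1 - (alpha - 1)) with (d - alpha) by ring.
      replace (d - (alpha - 1)) with (d - alpha + 1) by ring.
      replace (#i - (alpha - 1)) with (#(S i) - alpha) by (rewrite RtoC_S; ring).
      rewrite (rGamma_S (d - alpha)); Cring.
    + intros r Hle; replace (d - (alpha - 1) + #r) with (d - alpha + #(S r))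
        by (rewrite RtoC_S; ring); apply Hd; lia.
    + intros r Hle; replace (d - 1 - (alpha - 1) + #r) with (d - alpha + #r) by ring.
      apply Hd; lia.
Qed.

(** * The Pfaff-Saalschuetz sum *)

Lemma Csum_telescope (g : nat -> C) (n : nat) :
  sum_n (fun k => g (S k) - g k) n = g (S n) - g 0%nat.
Proof.
  induction n as [|n IH]; [now rewrite Csum_O|].
  rewrite Csum_S, IH; Cring.
Qed.

(** Up to the factor (e)_N/N! this is 3F2(-N, a, c; d, 1-e-N; 1), balanced by d = a+c+e. Written as
    a convolution it avoids the denominator (1-e-N)_n, so e is unrestricted. *)
Lemma saalschutz (a c e d : C) (N : nat) :
  d = a + c + e -> gamma_finite d ->
  sum_n (fun n => poch e (N - n) / #(fact (N - n))
                  * (poch a n * poch c n / (poch d n * #(fact n)))) N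
  = poch (c + e) N * poch (a + e) N / (poch d N * #(fact N)).
Proof.
  intros Hd Hfin.
  set (u m := poch e m / #(fact m)).
  set (v n := poch a n * poch c n / (poch d n * #(fact n))).
  assert (Hu : forall m, #(S m) * u (S m) = (e + #m) * u m).
  { intros m; unfold u; rewrite RtoC_fact_S; simpl poch; field; Cneq0. }
  assert (Hv : forall n, #(S n) * (d + #n) * v (S n) = (a + #n) * (c + #n) * v n).
  { intros n; unfold v; rewrite RtoC_fact_S; simpl poch.
    assert (Hp := poch_neq_0 d n Hfin); assert (Hq := gamma_finite_neq d n Hfin).
    field; Cneq0. }
  change (sum_n (fun n => u (N - n)%nat * v n) N
          = poch (c + e) N * poch (a + e) N / (poch d N * #(fact N))).
  induction N as [|N IH].
  - rewrite Csum_O; unfold u, v; simpl; Cfield; apply C1_nz.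
  - (* The sum is annihilated by (N+1)(d+N) S - (c+e+N)(a+e+N); [g] is the certificate. *)
    set (g n := - (u (S N - n)%nat * #n * (d + #n - 1) * v n)).
    assert (Hterm : forall n, (n <= N)%nat ->
      #(S N) * (d + #N) * (u (S N - n)%nat * v n)
      = (c + e + #N) * (a + e + #N) * (u (N - n)%nat * v n) + (g (S n) - g n)).
    { intros n Hn; unfold g.
      replace (S N - S n)%nat with (N - n)%nat by lia.
      set (m := (N - n)%nat).
      replace (S N - n)%nat with (S m) by (unfold m; lia).
      assert (HN : #N = #m + #n) by (rewrite <- RtoC_plus, <- plus_INR; do 2 f_equal; lia).
      transitivity (#(S m) * u (S m) * (d + #N + #n) * v n
                    + u (S m) * #n * (d + #n - 1) * v n);
        [rewrite !RtoC_S, HN; ring|].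
      transitivity ((c + e + #N) * (a + e + #N) * (u m * v n)
                    - u m * (#(S n) * (d + #n) * v (S n))
                    + u (S m) * #n * (d + #n - 1) * v n);
        [rewrite Hu, Hv, HN, Hd; ring | rewrite !RtoC_S; ring]. }
    assert (HS : #(S N) * (d + #N) * sum_n (fun n => u (S N - n)%nat * v n) (S N)
                 = (c + e + #N) * (a + e + #N) * sum_n (fun n => u (N - n)%nat * v n) N).
    { rewrite Csum_S, Nat.sub_diag, Cmult_plus_distr_l, <- !Csum_scal.
      rewrite (sum_n_ext_loc _ _ N Hterm), Csum_plus, Csum_telescope.
      unfold g; rewrite Nat.sub_diag, RtoC_S; simpl INR; Cring. }
    rewrite IH in HS.
    assert (Hp := poch_neq_0 d N Hfin); assert (Hq := gamma_finite_neq d N Hfin).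
    apply (f_equal (fun z => z / (#(S N) * (d + #N)))) in HS.
    transitivity (#(S N) * (d + #N) * sum_n (fun n => u (S N - n)%nat * v n) (S N)
                  / (#(S N) * (d + #N))); [symmetry; Cfield; Cneq0|].
    rewrite HS, RtoC_fact_S; simpl poch; Cfield; Cneq0.
Qed.

(** * Square and diagonal summation of double series *)

Lemma sum_triangle {G : AbelianMonoid} (f : nat -> nat -> G) (N : nat) :
  sum_n (fun k => sum_n (fun n => f (k - n)%nat n) k) N
  = sum_n (fun n => sum_n (fun m => f m n) (N - n)) N.
Proof.
  induction N as [|N IH]; [now rewrite !sum_O|].
  rewrite sum_Sn, IH, (sum_Sn (fun n => f (S N - n)%nat n)), plus_assoc, <- sum_n_plus.
  rewrite (sum_Sn (fun n => sum_n (fun m => f m n) (S N - n))), Nat.sub_diag, sum_O.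
  f_equal; apply sum_n_ext_loc; intros n Hn.
  now rewrite Nat.sub_succ_l, sum_Sn by exact Hn.
Qed.

Lemma sum_n_le_upper (x : nat -> R) (k n : nat) :
  (forall i, (0 <= x i)%R) -> (k <= n)%nat -> (sum_n x k <= sum_n x n)%R.
Proof.
  intros Hx Hk; induction Hk as [|n Hk IH]; [apply Rle_refl|].
  rewrite sum_Sn; unfold plus; simpl; generalize (Hx (S n)); lra.
Qed.

Lemma sum_n_le_loc (x y : nat -> R) (n : nat) :
  (forall i, (i <= n)%nat -> (x i <= y i)%R) -> (sum_n x n <= sum_n y n)%R.
Proof.
  induction n as [|n IH]; intros H; [rewrite !sum_O; now apply H|].
  rewrite !sum_Sn; apply Rplus_le_compat; [apply IH; intros; apply H; lia | now apply H].
Qed.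

Lemma sum_n_nonneg (x : nat -> R) (n : nat) :
  (forall i, (0 <= x i)%R) -> (0 <= sum_n x n)%R.
Proof.
  intros Hx; eapply Rle_trans; [|apply (sum_n_le_upper x 0); [exact Hx | lia]].
  rewrite sum_O; apply Hx.
Qed.

Lemma Cmod_sum_diff_le (x : nat -> C) (k n : nat) :
  (k <= n)%nat ->
  (Cmod (sum_n x n - sum_n x k)
   <= sum_n (fun i => Cmod (x i)) n - sum_n (fun i => Cmod (x i)) k)%R.
Proof.
  intros Hk; induction Hk as [|n Hk IH].
  - replace (sum_n x k - sum_n x k) with (RtoC 0) by Cring; rewrite Cmod_0; lra.
  - rewrite Csum_S, sum_Sn; unfold plus; simpl.
    replace (sum_n x n + x (S n) - sum_n x k) with ((sum_n x n - sum_n x k) + x (S n)) by Cring.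
    eapply Rle_trans; [apply Cmod_triangle | lra].
Qed.

Lemma filterlim_half : filterlim (fun n => n / 2)%nat eventually eventually.
Proof.
  intros P [N HN]; exists (2 * N)%nat; intros n Hn; apply HN.
  apply Nat.div_le_lower_bound; lia.
Qed.

(** The triangle m+n <= N lies in the square of side N and contains the one of side N/2. The two
    partial sums therefore differ by at most A(N) - A(N/2), which tends to 0 as [A] is increasing
    and bounded. *)
Lemma square_sum_lim (f : nat -> nat -> C) (l : C) :
  (exists M, forall N, (sum_n (fun m => sum_n (fun n => Cmod (f m n)) N) N <= M)%R) ->
  Cis_series (fun k => sum_n (fun n => f (k - n)%nat n) k) l ->
  Cis_lim_seq (fun N => sum_n (fun m => sum_n (fun n => f m n) N) N) l.
Proof.
  intros [M HM] Hl.
  set (A N := sum_n (fun n => sum_n (fun m => Cmod (f m n)) N) N).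
  assert (Hin : forall K n, (0 <= sum_n (fun m => Cmod (f m n)) K)%R)
    by (intros; apply sum_n_nonneg; intros; apply Cmod_ge_0).
  assert (HA : forall N, sum_n (fun m => sum_n (fun n => Cmod (f m n)) N) N = A N)
    by (intros N; apply (sum_n_switch (fun m n => Cmod (f m n)))).
  (* This covers both uses: constant [K] gives the monotonicity of [A], and K n = N-n places a
     square inside the triangle. *)
  assert (HAle : forall h K N, (h <= N)%nat -> (forall n, (n <= h)%nat -> (h <= K n)%nat) ->
    (A h <= sum_n (fun n => sum_n (fun m => Cmod (f m n)) (K n)) N)%R).
  { intros h K N HhN HK.
    eapply Rle_trans; [|apply (sum_n_le_upper _ h); [intros; apply Hin | exact HhN]].
    apply sum_n_le_loc; intros n Hn; apply sum_n_le_upper; [intros; apply Cmod_ge_0 | now apply HK]. }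
  assert (Hconv : ex_finite_lim_seq A).
  { apply ex_finite_lim_seq_incr with M.
    - intros n; apply (HAle n (fun _ => S n) (S n)); intros; lia.
    - intros n; rewrite <- HA; apply HM. }
  destruct Hconv as [L HL].
  set (err N := sum_n (fun m => sum_n (fun n => f m n) N) N
                - sum_n (fun k => sum_n (fun n => f (k - n)%nat n) k) N).
  assert (Herr : Cis_lim_seq err 0).
  { apply Cis_lim_seq_0_le with (fun N => (A N - A (N / 2)%nat)%R).
    - intros N; unfold err.
      rewrite sum_triangle, (sum_n_switch f).
      apply Rle_trans with (A N - sum_n (fun n => sum_n (fun m => Cmod (f m n)) (N - n)) N)%R.
      + replace (_ - _) with (sum_n (fun n => sum_n (fun m => f m n) N
                                              + - (1) * sum_n (fun m => f m n) (N - n)) N)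
          by (rewrite Csum_plus, Csum_scal; Cring).
        eapply Rle_trans; [apply Cmod_Csum_le|].
        unfold A; apply Rle_minus_r.
        eapply Rle_trans; [right; symmetry; apply (sum_n_plus (G := R_AbelianMonoid))|].
        apply sum_n_le_loc; intros n Hn; unfold plus; simpl.
        assert (H := Cmod_sum_diff_le (fun m => f m n) (N - n) N ltac:(lia)).
        replace (sum_n (fun m => f m n) N + - (1) * sum_n (fun m => f m n) (N - n))
          with (sum_n (fun m => f m n) N - sum_n (fun m => f m n) (N - n)) by Cring.
        lra.
      + apply Rplus_le_compat_l, Ropp_le_contravar, (HAle (N / 2)%nat (fun n => (N - n)%nat)).
        * apply Nat.Div0.div_le_upper_bound; lia.
        * intros n Hn; assert (2 * (N / 2) <= N)%nat by apply Nat.Div0.mul_div_le; lia.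
    - replace (Finite 0) with (Finite (L - L)) by (f_equal; ring).
      apply is_lim_seq_minus'; [exact HL|].
      apply (is_lim_seq_subseq A _ _ filterlim_half HL). }
  assert (H := Cis_lim_seq_plus _ _ _ _ Herr Hl).
  rewrite Cplus_0_l in H; apply Cis_lim_seq_ext with (2 := H).
  intros N; unfold err; Cring.
Qed.

(** * Reduction of the Kampe de Feriet function *)

Lemma Cnpow_plus (z : C) (m n : nat) : Cnpow z (m + n) = Cnpow z m * Cnpow z n.
Proof. induction m as [|m IH]; simpl; [ring | rewrite IH; ring]. Qed.

(** On a diagonal (alpha)_N, (beta)_N and the power of 1/2 are constant. The Saalschuetz sum with a
    = beta-eps and e = eps yields (beta)_N (c+eps)_N, so (beta)_N cancels. *)
Lemma kdf_diagonal (alpha beta eps c d : C) (N : nat) :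
  d = c + beta -> gamma_finite beta -> gamma_finite d ->
  sum_n (fun n => kdf_term [alpha] [beta] [eps] [] [beta - eps; c] [d]
                    (RtoC (/ 2)) (RtoC (/ 2)) (N - n) n) N
  = / rGamma d * hyp_term alpha (c + eps) d N.
Proof.
  intros Hd Hb Hfin.
  assert (Hpb := poch_neq_0 beta N Hb); assert (Hpd := poch_neq_0 d N Hfin).
  assert (Hrd := rGamma_neq_0 d Hfin).
  rewrite (sum_n_ext_loc _ (fun n => poch alpha N / poch beta N * Cnpow (RtoC (/ 2)) N
    * (poch eps (N - n) / #(fact (N - n))
       * (poch (beta - eps) n * poch c n / (poch d n * #(fact n)))))).
  2: { intros n Hn; unfold kdf_term; simpl prod_poch.
       replace (N - n + n)%nat with N by lia.
       replace (Cnpow (RtoC (/ 2)) N) with (Cnpow (RtoC (/ 2)) (N - n) * Cnpow (RtoC (/ 2)) n)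
         by (rewrite <- Cnpow_plus; f_equal; lia).
       assert (Hpn := poch_neq_0 d n Hfin); Cfield; Cneq0. }
  rewrite Csum_scal, (saalschutz (beta - eps) c eps d N) by (trivial; rewrite Hd; ring).
  replace (beta - eps + eps) with beta by ring.
  unfold hyp_term; rewrite (rGamma_poch d N) in Hrd |- *.
  assert (Hg : rGamma (d + #N) <> 0) by (intros H; apply Hrd; rewrite H; ring).
  Cfield; Cneq0.
Qed.

Lemma KdF_eq_hyp (alpha beta eps c d : C) :
  d = c + beta -> nonpos_int_free [beta; d] ->
  kdf_abs_conv [alpha] [beta] [eps] [] [beta - eps; c] [d] (RtoC (/ 2)) (RtoC (/ 2)) ->
  KdF [alpha] [beta] [eps] [] [beta - eps; c] [d] (RtoC (/ 2)) (RtoC (/ 2))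
  = / rGamma d * hyp alpha (c + eps) d.
Proof.
  intros Hd Hfree Habs.
  assert (Hb := Forall_inv Hfree); assert (Hfin := Forall_inv (Forall_inv_tail Hfree)).
  apply Clim_seq_correct, square_sum_lim; [exact Habs|].
  apply Cis_series_ext with (fun N => / rGamma d * hyp_term alpha (c + eps) d N).
  - intros N; symmetry; now apply kdf_diagonal.
  - apply Cis_series_scal, hyp_series.
Qed.

Theorem theorem1 (i : nat) (alpha beta eps : C) :
  let I := RtoC (INR i) in
  let half := RtoC (/ 2) in
  (* first identity *)
  (nonpos_int_free [beta; 1 - alpha - eps + beta + I] ->
   kdf_abs_conv [alpha] [beta] [eps] [] [beta - eps; 1 - alpha - eps + I]
                [1 - alpha - eps + beta + I] half half ->
   gamma_finite (beta - eps - alpha + I + 1) ->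
   gamma_finite (alpha - I) ->
   gamma_finite (1 - 2 * alpha - eps + beta + I) ->
   gamma_finite alpha ->
   (forall r : nat, (r <= i)%nat ->
      gamma_finite ((1 - 2 * alpha - eps + beta + I + RtoC (INR r)) / 2) /\
      gamma_finite ((beta - eps - I + RtoC (INR r) + 1) / 2)) ->
   KdF [alpha] [beta] [eps] [] [beta - eps; 1 - alpha - eps + I]
       [1 - alpha - eps + beta + I] half half
   = Crpow 2 (I - alpha) * CGamma (beta - eps - alpha + I + 1) * CGamma (alpha - I)
       / (CGamma (1 - 2 * alpha - eps + beta + I) * CGamma alpha)
     * sum_n (fun r => Csign r * Cbinom i r
          * CGamma ((1 - 2 * alpha - eps + beta + I + RtoC (INR r)) / 2)
          / CGamma ((beta - eps - I + RtoC (INR r) + 1) / 2)) i)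
  /\
  (* second identity *)
  (nonpos_int_free [beta; 1 - alpha - eps + beta - I] ->
   kdf_abs_conv [alpha] [beta] [eps] [] [beta - eps; 1 - alpha - eps - I]
                [1 - alpha - eps + beta - I] half half ->
   gamma_finite (beta - eps - alpha - I + 1) ->
   gamma_finite (1 - 2 * alpha - eps + beta - I) ->
   (forall r : nat, (r <= i)%nat ->
      gamma_finite ((1 - 2 * alpha - eps + beta - I + RtoC (INR r)) / 2) /\
      gamma_finite ((beta - eps - I + RtoC (INR r) + 1) / 2)) ->
   KdF [alpha] [beta] [eps] [] [beta - eps; 1 - alpha - eps - I]
       [1 - alpha - eps + beta - I] half half
   = Crpow 2 (- alpha - I) * CGamma (beta - eps - alpha - I + 1)
       / CGamma (1 - 2 * alpha - eps + beta - I)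
     * sum_n (fun r => Cbinom i r
          * CGamma ((1 - 2 * alpha - eps + beta - I + RtoC (INR r)) / 2)
          / CGamma ((beta - eps - I + RtoC (INR r) + 1) / 2)) i).
Proof.
  intros I half; split.
  - set (d := 1 - alpha - eps + beta + I).
    replace (beta - eps - alpha + I + 1) with d by (unfold d; ring).
    replace (1 - 2 * alpha - eps + beta + I) with (d - alpha) by (unfold d; ring).
    intros Hfree Habs Hd Ha1 Hda Ha Hr.
    (* Numerator Gamma values of the sum over r are denominators in terms of [rGamma]; their
       finiteness gives the required nonvanishing. *)
    assert (Hnum : forall r, (r <= i)%nat -> rGamma ((d - alpha + #r) / 2) <> 0)
      by (intros r Hle; now apply rGamma_neq_0, Hr).
    rewrite KdF_eq_hyp by (trivial; unfold d; ring).
    replace (1 - alpha - eps + I + eps) with (1 - alpha + I) by ring.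
    assert (Hmain := hyp_bailey_raise i alpha d Hnum); fold I in Hmain.
    rewrite (sum_n_ext_loc _ (fun r => Cbinom i r * (Csign r
      * (rGamma ((d + alpha - 2 * I + #r) / 2) / rGamma ((d - alpha + #r) / 2))))).
    2: { intros r Hle; destruct (Hr r Hle) as [H1 H2].
         rewrite !CGamma_eq_inv_rGamma by assumption.
         assert (K1 := rGamma_neq_0 _ H1); assert (K2 := rGamma_neq_0 _ H2).
         replace (beta - eps - I + #r + 1) with (d + alpha - 2 * I + #r) in K2 |- *
           by (unfold d; ring).
         Cfield; Cneq0. }
    rewrite !CGamma_eq_inv_rGamma by assumption.
    assert (Kd := rGamma_neq_0 d Hd); assert (Kda := rGamma_neq_0 _ Hda).
    assert (Ka := rGamma_neq_0 alpha Ha).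
    (* This identifies Gamma(alpha-i)/Gamma(alpha) with 1/(alpha-i)_i, the factor left on the other
       side in [hyp_bailey_raise]. *)
    assert (Ea := rGamma_poch (alpha - I) i); fold I in Ea.
    replace (alpha - I + I) with alpha in Ea by ring.
    assert (Kp := poch_neq_0 (alpha - I) i Ha1).
    transitivity (/ (rGamma d * poch (alpha - I) i)
                  * (poch (alpha - I) i * hyp alpha (1 - alpha + I) d)); [field; Cneq0|].
    rewrite Hmain, Ea; Cfield; Cneq0.
  - set (d := 1 - alpha - eps + beta - I).
    replace (beta - eps - alpha - I + 1) with d by (unfold d; ring).
    replace (1 - 2 * alpha - eps + beta - I) with (d - alpha) by (unfold d; ring).
    intros Hfree Habs Hd Hda Hr.
    assert (Hnum : forall r, (r <= i)%nat -> rGamma ((d - alpha + #r) / 2) <> 0)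
      by (intros r Hle; now apply rGamma_neq_0, Hr).
    rewrite KdF_eq_hyp by (trivial; unfold d; ring).
    replace (1 - alpha - eps - I + eps) with (1 - alpha - I) by ring.
    assert (Hmain := hyp_bailey_lower i alpha d Hnum); fold I in Hmain.
    rewrite (sum_n_ext_loc _ (fun r => Cbinom i r
      * (rGamma ((d + alpha + #r) / 2) / rGamma ((d - alpha + #r) / 2)))).
    2: { intros r Hle; destruct (Hr r Hle) as [H1 H2].
         rewrite !CGamma_eq_inv_rGamma by assumption.
         assert (K1 := rGamma_neq_0 _ H1); assert (K2 := rGamma_neq_0 _ H2).
         replace (beta - eps - I + #r + 1) with (d + alpha + #r) in K2 |- *
           by (unfold d; ring).
         Cfield; Cneq0. }
    rewrite !CGamma_eq_inv_rGamma by assumption.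
    assert (Kd := rGamma_neq_0 d Hd); assert (Kda := rGamma_neq_0 _ Hda).
    rewrite Hmain; Cfield; Cneq0.
Qed.
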